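(* Let $f\colon\mathbb C\to\mathbb C$ be an entire transcendental function, let $\delta\in\mathbb C\setminus\{0\}$, and let $F\colon\mathbb C^2\to\mathbb C^2$ be the transcendental Hénon map $F(z,w)=(f(z)-\delta w,\,z)$. Then $F$ has a periodic orbit, i.e. there exist a point $p\in\mathbb C^2$ and an integer $n\ge 1$ with $F^n(p)=p$.
   Context: An entire function $f\colon\mathbb C\to\mathbb C$ is transcendental if it is not a polynomial. $F^n$ denotes the $n$-th iterate of $F$. *)

(* Defs.v *)
From Stdlib Require Import Reals.
From Coquelicot Require Import Coquelicot.

(* The scalar field [C_AbsRing] makes this complex differentiability. *)
Definition entire (f : C -> C) : Prop :=
  forall z : C, @ex_derive C_AbsRing C_NormedModule f z.

(* [sum_n u N] is u 0 + ... + u N, with N + 1 terms. *)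
Definition is_polynomial (f : C -> C) : Prop :=
  exists (N : nat) (a : nat -> C),
    forall z : C, f z = sum_n (fun k : nat => (a k * z ^ k)%C) N.

Definition transcendental (f : C -> C) : Prop := ~ is_polynomial f.

Definition henon (f : C -> C) (delta : C) (p : C * C) : C * C :=
  ((f (fst p) - delta * snd p)%C, fst p).

(* Main.v *)
Require Import Defs.
From Stdlib Require Import Reals Lra Lia ClassicalEpsilon.
From Coquelicot Require Import Coquelicot.

(**
If [f z = (1 + delta) z] (for [delta = -1]: [f z = 0]) has a solution, it gives a fixed point of [F].
Otherwise there is a zero-free entire function [k], not affine, in terms of which a periodic orbit
is a solution of translation-invariant equations: for [delta <> -1] put
[k z = f z / (1 + delta) - z]; a solution of [k (u + k u) = - k u] yields the orbit of period 2 of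
[(u, u + k u)]. For [delta = -1] put [k = f]; a solution of [k (v + k u) = - k v],
[k (u - k v) = - k u] yields the orbit of period 4 of [(u, v)].

These equations are invariant under [k z -> k (w + s z) / s]. A renormalisation in the style of
Zalcman and Pang shows that suitable rescalings of [k] are of the form [exp (z + E z)] with [E]
small in the C^1 sense on a large disc, and for such functions the equations are solved by the
contraction principle near the solution [exp z = i pi] for [E = 0]. In the renormalisation, write
[k = exp g]; a large disc around a point that nearly minimises [|k z| / (R - |z|)] among the points
with [|k' z| > 1] is rescaled so that [Re g] has bounded gradient on its zero set. The boundary
Harnack inequality then makes [Re g] grow linearly, so that [g] is almost affine.
*)

Local Open Scope R_scope.

(** * Complex derivatives and mean values over curves *)

(** For [k = exp] the equation [k (u + k u) = - k u] reads [exp (exp u) = -1], which holds as soon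
    as [exp u = i pi]. The derivative of [exp u] at such a point is [i pi], not 0, so the solution
    survives perturbations that are small in the C^1 sense. This is the model that the rescaling has
    to reach. The values of [k] are added to points, so values and variable must be scaled by the
    same factor. Such a rescaling leaves the derivative of [k] unchanged, which is why the selection
    rests on a threshold for [|k'|] itself. A point with [|k'| > 1] exists by Liouville's theorem:
    otherwise [k] is affine and [f] a polynomial. Transcendence enters only here. That [k] has no
    zeros gives the logarithm [g] and keeps the minimised quotient away from 0. No limit of rescaled
    functions is taken. The contraction argument looks only at the disc of radius 20 and tolerates
    an error of 1/100 there, so explicit estimates on one large disc take the place of normal
    families. *)

Local Notation CV := (AbsRing_NormedModule C_AbsRing).

(* Coquelicot's product and chain rules require the codomain to be the scalar field seen as a
   module over itself; [C_NormedModule] carries the product uniform structure instead. *)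
Definition Cder (f : C -> C) (z l : C) : Prop := @is_derive C_AbsRing CV f z l.

Lemma locally_CV (x : C) (P : C -> Prop) :
  @locally CV x P <-> exists d, 0 < d /\ forall y, Cmod (y - x) < d -> P y.
Proof.
  split.
  - intros [d Hd]; exists d; split; [apply cond_pos|]; intros y Hy; apply Hd; exact Hy.
  - intros [d [H Hd]]; exists (mkposreal d H); intros y Hy; apply Hd; exact Hy.
Qed.

Lemma Cder_eps (f : C -> C) (z l : C) :
  Cder f z l <-> forall eps, 0 < eps -> exists d, 0 < d /\
    forall w, Cmod (w - z) < d -> Cmod (f w - f z - l * (w - z)) <= eps * Cmod (w - z).
Proof.
  split.
  - intros [_ H] eps He.
    specialize (H z (fun P HP => HP) (mkposreal eps He)).
    apply locally_CV in H. destruct H as [d [Hd H]]. exists d; split; auto.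
    intros w Hw. specialize (H w Hw). simpl in H.
    replace (f w - f z - l * (w - z))%C with (minus (minus (f w) (f z)) (scal (minus w z) l)).
    + exact H.
    + change (f w - f z - (w - z) * l = f w - f z - l * (w - z))%C. ring.
  - intros H. split.
    + apply is_linear_scal_l.
    + intros x Hx. apply (@is_filter_lim_locally_unique C_AbsRing CV z x) in Hx. subst x.
      intros eps. destruct (H eps (cond_pos eps)) as [d [Hd Hw]].
      apply locally_CV. exists d; split; auto. intros w Hdw.
      specialize (Hw w Hdw).
      replace (f w - f z - l * (w - z))%C with (minus (minus (f w) (f z)) (scal (minus w z) l)) in Hw.
      * exact Hw.
      * change (f w - f z - (w - z) * l = f w - f z - l * (w - z))%C. ring.
Qed.

Lemma Cder_ext (f g : C -> C) (z l : C) : (forall w, f w = g w) -> Cder f z l -> Cder g z l.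
Proof. intros H. apply is_derive_ext. exact H. Qed.
Lemma Cder_eq (f : C -> C) (z l l' : C) : Cder f z l -> l = l' -> Cder f z l'.
Proof. intros H <-. exact H. Qed.
Lemma Cder_const (a z : C) : Cder (fun _ => a) z 0.
Proof. apply (is_derive_const (K:=C_AbsRing) (V:=CV)). Qed.
Lemma Cder_id (z : C) : Cder (fun w => w) z 1.
Proof. apply (is_derive_id (K:=C_AbsRing)). Qed.
Lemma Cder_plus (f g : C -> C) (z lf lg : C) : Cder f z lf -> Cder g z lg ->
  Cder (fun w => f w + g w)%C z (lf + lg).
Proof. apply (is_derive_plus (K:=C_AbsRing) (V:=CV)). Qed.
Lemma Cder_minus (f g : C -> C) (z lf lg : C) : Cder f z lf -> Cder g z lg ->
  Cder (fun w => f w - g w)%C z (lf - lg).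
Proof. apply (is_derive_minus (K:=C_AbsRing) (V:=CV)). Qed.
Lemma Cder_mult (f g : C -> C) (z lf lg : C) : Cder f z lf -> Cder g z lg ->
  Cder (fun w => f w * g w)%C z (lf * g z + f z * lg).
Proof. intros Hf Hg. apply (is_derive_mult (K:=C_AbsRing) f g); auto. intros; apply Cmult_comm. Qed.
Lemma Cder_comp (f g : C -> C) (z lf lg : C) : Cder f (g z) lf -> Cder g z lg ->
  Cder (fun w => f (g w)) z (lg * lf).
Proof. intros Hf Hg. apply (is_derive_comp (K:=C_AbsRing) (V:=CV) f g); auto. Qed.

Lemma entire_Cder (f : C -> C) : entire f -> exists f', forall z, Cder f z (f' z).
Proof.
  intros H. exists (fun z => C_derive f z). intros z.
  assert (Hd := C_derive_correct f z 0%C (H z)).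
  destruct Hd as [_ Hd].
  (* The little-o condition involves only the modulus, which is the norm of both modules, so it
     carries over as it is; only linearity is proved afresh. *)
  split. apply is_linear_scal_l. exact Hd.
Qed.

Lemma Cder_scal (c : C) (f : C -> C) (z l : C) : Cder f z l -> Cder (fun w => c * f w)%C z (c * l).
Proof.
  intros H. replace (c * l)%C with (0 * f z + c * l)%C by ring.
  apply Cder_mult; auto. apply Cder_const.
Qed.

Lemma Cmod_triangle_rev (x y : C) : Cmod x - Cmod y <= Cmod (x - y).
Proof.
  assert (H := Cmod_triangle (x - y) y).
  replace (x - y + y)%C with x in H by ring. lra.
Qed.

Lemma Cmod_minus_sym (x y : C) : Cmod (x - y) = Cmod (y - x).
Proof. rewrite <- Cmod_opp. f_equal. ring. Qed.

Lemma Cder_inv (z : C) : z <> 0 -> Cder Cinv z (- / (z * z))%C.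
Proof.
  intros Hz. apply Cder_eps. intros eps He.
  assert (Hm : 0 < Cmod z) by (apply Cmod_gt_0; auto).
  set (m := Cmod z) in *.
  exists (Rmin (m / 2) (eps * (m * m * m) / 2)). split.
  - apply Rmin_pos; [lra|]. apply Rmult_lt_0_compat; [|lra].
    repeat apply Rmult_lt_0_compat; auto.
  - intros w Hw.
    assert (H1 := Rlt_le_trans _ _ _ Hw (Rmin_l _ _)).
    assert (H2 := Rlt_le_trans _ _ _ Hw (Rmin_r _ _)).
    assert (Hwm : m / 2 <= Cmod w).
    { assert (H := Cmod_triangle_rev z w). rewrite Cmod_minus_sym in H. fold m in H. lra. }
    assert (Hw0 : w <> 0). { apply Cmod_gt_0. lra. }
    replace (/ w - / z - - / (z * z) * (w - z))%C with ((w - z) * (w - z) * (/ (z * z) * / w))%C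
      by (field; auto).
    rewrite !Cmod_mult, !Cmod_inv, Cmod_mult by (auto using Cmult_neq_0).
    fold m. set (h := Cmod (w - z)) in *.
    assert (0 <= h) by apply Cmod_ge_0.
    assert (Hi : / Cmod w <= / (m / 2)) by (apply Rinv_le_contravar; lra).
    apply Rle_trans with (h * h * (/ (m * m) * / (m / 2))).
    + apply Rmult_le_compat_l; [nra|]. apply Rmult_le_compat_l; auto.
      left; apply Rinv_0_lt_compat; nra.
    + replace (h * h * (/ (m * m) * / (m / 2))) with (h * (h / (m * m * m / 2))) by (field; lra).
      rewrite (Rmult_comm eps h). apply Rmult_le_compat_l; auto.
      assert (0 < m * m * m) by (repeat apply Rmult_lt_0_compat; auto).
      apply Rle_div_l; lra.
Qed.

Definition Ccont (f : C -> C) (z : C) : Prop := @continuous CV CV f z.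
Definition curve_cont (g : R -> C) : Prop := forall t, @continuous R_UniformSpace CV g t.

Lemma Cder_cont (f : C -> C) (z l : C) : Cder f z l -> Ccont f z.
Proof. intros H. apply (ex_derive_continuous (K:=C_AbsRing) (V:=CV) f z). exists l; exact H. Qed.

Lemma Ccont_eps (f : C -> C) (z : C) : Ccont f z <->
  forall eps, 0 < eps -> exists d, 0 < d /\ forall w, Cmod (w - z) < d -> Cmod (f w - f z) < eps.
Proof.
  split.
  - intros H eps He.
    assert (H' := proj1 (filterlim_locally _ _) H (mkposreal eps He)).
    apply locally_CV in H'. exact H'.
  - intros H. apply filterlim_locally. intros eps. apply locally_CV.
    exact (H eps (cond_pos eps)).
Qed.

Lemma curve_cont_comp (f : C -> C) (g : R -> C) :
  curve_cont g -> (forall t, Ccont f (g t)) -> curve_cont (fun t => f (g t)).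
Proof. intros Hg Hf t. apply (continuous_comp (V:=CV) (W:=CV) g f t); [apply Hg|apply Hf]. Qed.
Lemma curve_cont_plus (f g : R -> C) : curve_cont f -> curve_cont g -> curve_cont (fun t => f t + g t)%C.
Proof. intros Hf Hg t. apply (continuous_plus (V:=CV) f g t); auto. Qed.
Lemma curve_cont_minus (f g : R -> C) : curve_cont f -> curve_cont g -> curve_cont (fun t => f t - g t)%C.
Proof. intros Hf Hg t. apply (continuous_minus (V:=CV) f g t); auto. Qed.
Lemma curve_cont_mult (f g : R -> C) : curve_cont f -> curve_cont g -> curve_cont (fun t => f t * g t)%C.
Proof. intros Hf Hg t. apply (continuous_mult (K:=C_AbsRing) f g t); auto. Qed.
Lemma curve_cont_const (c : C) : curve_cont (fun _ => c).
Proof. intros t. apply continuous_const. Qed.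
Lemma curve_cont_inv (f : R -> C) : curve_cont f -> (forall t, f t <> 0) -> curve_cont (fun t => / f t)%C.
Proof. intros Hf H. apply curve_cont_comp; auto. intros t. eapply Cder_cont, Cder_inv, H. Qed.

Lemma im_le_Cmod (c : C) : Rabs (Im c) <= Cmod c.
Proof.
  eapply Rle_trans; [apply Rmax_r|apply Rmax_Cmod].
Qed.

Lemma Cmod_le_Re_Im (c : C) : Cmod c <= Rabs (Re c) + Rabs (Im c).
Proof.
  replace c with ((RtoC (Re c)) + Ci * (RtoC (Im c)))%C at 1.
  - eapply Rle_trans; [apply Cmod_triangle|].
    rewrite Cmod_mult, Cmod_Ci, !Cmod_R. lra.
  - destruct c; unfold Ci, RtoC, Cmult, Cplus; simpl. f_equal; ring.
Qed.

Lemma curve_cont_Re (g : R -> C) : curve_cont g -> forall t, continuous (fun t : R => Re (g t)) t.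
Proof.
  intros H t. apply filterlim_locally. intros eps.
  generalize (proj1 (filterlim_locally _ _) (H t) eps). apply filter_imp.
  intros s Hs. apply Rle_lt_trans with (2 := Hs).
  change (Rabs (Re (g s) - Re (g t)) <= Cmod (g s - g t)).
  replace (Re (g s) - Re (g t)) with (Re (g s - g t)) by reflexivity. apply re_le_Cmod.
Qed.
Lemma curve_cont_Im (g : R -> C) : curve_cont g -> forall t, continuous (fun t : R => Im (g t)) t.
Proof.
  intros H t. apply filterlim_locally. intros eps.
  generalize (proj1 (filterlim_locally _ _) (H t) eps). apply filter_imp.
  intros s Hs. apply Rle_lt_trans with (2 := Hs).
  change (Rabs (Im (g s) - Im (g t)) <= Cmod (g s - g t)).
  replace (Im (g s) - Im (g t)) with (Im (g s - g t)) by reflexivity. apply im_le_Cmod.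
Qed.
Lemma curve_cont_pair (f g : R -> R) : (forall t, continuous f t) -> (forall t, continuous g t) ->
  curve_cont (fun t => (f t, g t)).
Proof.
  intros Hf Hg t. apply filterlim_locally. intros eps.
  assert (He : 0 < eps / 2) by (generalize (cond_pos eps); lra).
  generalize (filter_and _ _ (proj1 (filterlim_locally _ _) (Hf t) (mkposreal _ He))
    (proj1 (filterlim_locally _ _) (Hg t) (mkposreal _ He))).
  apply filter_imp. intros s [H1 H2].
  change (Rabs (f s - f t) < eps / 2) in H1. change (Rabs (g s - g t) < eps / 2) in H2.
  change (Cmod ((f s, g s) - (f t, g t)) < eps).
  eapply Rle_lt_trans; [apply Cmod_le_Re_Im|]. simpl.
  change (Rabs (f s - f t) + Rabs (g s - g t) < eps). lra.
Qed.

(** Only [0, 1] matters, but curves are functions on all of [R] and continuous everywhere, so that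
    integrability never needs a condition on the range. *)
Definition mean (g : R -> C) : C := (RInt (fun t => Re (g t)) 0 1, RInt (fun t => Im (g t)) 0 1).

Lemma ex_RInt_cont (f : R -> R) (a b : R) : (forall t, continuous f t) -> ex_RInt f a b.
Proof. intros H. apply (ex_RInt_continuous (V:=R_CompleteNormedModule)). intros; apply H. Qed.

Lemma mean_ext (f g : R -> C) : (forall t, f t = g t) -> mean f = mean g.
Proof. intros H. unfold mean. f_equal; apply RInt_ext; intros; rewrite H; auto. Qed.
Lemma mean_plus (f g : R -> C) : curve_cont f -> curve_cont g ->
  mean (fun t => f t + g t)%C = (mean f + mean g)%C.
Proof.
  intros Hf Hg. unfold mean, Cplus; simpl. f_equal.
  - apply (RInt_plus (V:=R_CompleteNormedModule)); apply ex_RInt_cont; apply curve_cont_Re; auto.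
  - apply (RInt_plus (V:=R_CompleteNormedModule)); apply ex_RInt_cont; apply curve_cont_Im; auto.
Qed.
Lemma RInt_scal_R (c : R) (f : R -> R) (a b : R) : (forall t, continuous f t) ->
  RInt (fun t => c * f t) a b = c * RInt f a b.
Proof. intros H. apply (RInt_scal (V:=R_CompleteNormedModule)). apply ex_RInt_cont; auto. Qed.
Lemma mean_scal (c : C) (f : R -> C) : curve_cont f -> mean (fun t => c * f t)%C = (c * mean f)%C.
Proof.
  intros Hf. destruct c as [x y]. unfold mean, Cmult; simpl.
  assert (HR := curve_cont_Re _ Hf). assert (HI := curve_cont_Im _ Hf).
  assert (Hs : forall (k : R) (h : R -> R), (forall t, continuous h t) -> forall t, continuous (fun t => k * h t) t).
  { intros k h Hh t. apply (continuous_scal_r (V:=R_NormedModule) k h t). auto. }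
  f_equal.
  - rewrite <- !RInt_scal_R by auto.
    apply (RInt_minus (V:=R_CompleteNormedModule)); apply ex_RInt_cont; intros t; apply Hs; auto.
  - rewrite <- !RInt_scal_R by auto.
    apply (RInt_plus (V:=R_CompleteNormedModule)); apply ex_RInt_cont; intros t; apply Hs; auto.
Qed.
Lemma mean_minus (f g : R -> C) : curve_cont f -> curve_cont g ->
  mean (fun t => f t - g t)%C = (mean f - mean g)%C.
Proof.
  intros Hf Hg. transitivity (mean (fun t => f t + (-(1)) * g t)%C).
  - apply mean_ext; intros; ring.
  - rewrite mean_plus, mean_scal; auto. ring. apply curve_cont_mult; auto. apply curve_cont_const.
Qed.
Lemma mean_const (c : C) : mean (fun _ => c) = c.
Proof.
  destruct c as [x y]. unfold mean; simpl. rewrite !RInt_const.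
  unfold scal; simpl; unfold mult; simpl. f_equal; ring.
Qed.
Lemma mean_conj (f : R -> C) : curve_cont f -> mean (fun t => Cconj (f t)) = Cconj (mean f).
Proof.
  intros H. unfold mean, Cconj; simpl. f_equal.
  apply (RInt_opp (V:=R_CompleteNormedModule)). apply ex_RInt_cont, curve_cont_Im, H.
Qed.
Lemma Re_mean_ge (f : R -> C) (m : R) : curve_cont f -> (forall t, m <= Re (f t)) -> m <= Re (mean f).
Proof.
  intros Hf H. simpl.
  replace m with (RInt (fun _ => m) 0 1).
  - apply RInt_le; [lra|apply ex_RInt_const|apply ex_RInt_cont, curve_cont_Re, Hf|auto].
  - rewrite RInt_const. unfold scal; simpl; unfold mult; simpl. ring.
Qed.
(** Estimating the two components separately would lose a factor. Viewed as one integral in the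
    plane with its Euclidean norm, the mean satisfies the bound with constant 1. *)
Lemma Cmod_mean_le (f : R -> C) (M : R) : curve_cont f -> (forall t, 0 <= t <= 1 -> Cmod (f t) <= M) -> Cmod (mean f) <= M.
Proof.
  intros Hf H.
  assert (HI : @is_RInt C_R_NormedModule f 0 1 (mean f)).
  { apply (is_RInt_fct_extend_pair (U:=R_NormedModule) (V:=R_NormedModule));
    apply (RInt_correct (V:=R_CompleteNormedModule)), ex_RInt_cont;
    [apply (curve_cont_Re f Hf)|apply (curve_cont_Im f Hf)]. }
  assert (Hn : forall z : C, @norm R_AbsRing C_R_NormedModule z = Cmod z).
  { intros [x y]. unfold norm; simpl. unfold prod_norm, Cmod. simpl. unfold norm; simpl. unfold abs; simpl.
    f_equal. rewrite !Rmult_1_r, <- !Rabs_mult, !Rabs_pos_eq; nra. }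
  rewrite <- Hn.
  apply (norm_RInt_le (V:=C_R_NormedModule) f (fun _ => M) 0 1 _ M); auto; try lra.
  - intros x Hx. rewrite Hn. auto.
  - assert (Hc := is_RInt_const (V:=R_NormedModule) 0 1 M).
    refine (eq_ind _ (fun v : R => @is_RInt R_NormedModule (fun _ => M) 0 1 v) Hc M _).
    unfold scal; simpl; unfold mult; simpl; ring.
Qed.

Lemma is_derive_eps (f : R -> R) (x l : R) :
  is_derive f x l <-> forall eps, 0 < eps -> exists d, 0 < d /\
    forall y, Rabs (y - x) < d -> Rabs (f y - f x - l * (y - x)) <= eps * Rabs (y - x).
Proof.
  split.
  - intros [_ H] eps He.
    specialize (H x (fun P HP => HP) (mkposreal eps He)).
    destruct H as [d H]. exists d; split; [apply cond_pos|].
    intros w Hw. specialize (H w Hw). simpl in H.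
    rewrite (Rmult_comm l). exact H.
  - intros H. split.
    + apply is_linear_scal_l.
    + intros z Hz. apply (@is_filter_lim_locally_unique R_AbsRing R_NormedModule x z) in Hz. subst z.
      intros eps. destruct (H eps (cond_pos eps)) as [d [Hd Hw]].
      exists (mkposreal d Hd). intros w Hdw.
      specialize (Hw w Hdw). rewrite (Rmult_comm l) in Hw. exact Hw.
Qed.

(** Written with epsilons because the chain rule [curve_der_comp] mixes a complex derivative outside
    with a real parameter inside. *)
Definition curve_der (g : R -> C) (t : R) (v : C) : Prop :=
  forall eps, 0 < eps -> exists d, 0 < d /\
    forall s, Rabs (s - t) < d -> Cmod (g s - g t - v * RtoC (s - t)) <= eps * Rabs (s - t).

Lemma curve_der_Re (g : R -> C) (t : R) (v : C) :
  curve_der g t v -> is_derive (fun s => Re (g s)) t (Re v).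
Proof.
  intros H. apply is_derive_eps. intros eps He. destruct (H eps He) as [d [Hd Hs]].
  exists d; split; auto. intros s Hsd. eapply Rle_trans; [|apply Hs; auto].
  replace (Re (g s) - Re (g t) - Re v * (s - t)) with (Re (g s - g t - v * RtoC (s - t))%C).
  - apply re_le_Cmod.
  - destruct (g s), (g t), v; simpl. ring.
Qed.
Lemma curve_der_Im (g : R -> C) (t : R) (v : C) :
  curve_der g t v -> is_derive (fun s => Im (g s)) t (Im v).
Proof.
  intros H. apply is_derive_eps. intros eps He. destruct (H eps He) as [d [Hd Hs]].
  exists d; split; auto. intros s Hsd. eapply Rle_trans; [|apply Hs; auto].
  replace (Im (g s) - Im (g t) - Im v * (s - t)) with (Im (g s - g t - v * RtoC (s - t))%C).
  - apply im_le_Cmod.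
  - destruct (g s), (g t), v; simpl. ring.
Qed.
Lemma curve_der_pair (f g : R -> R) (t a b : R) :
  is_derive f t a -> is_derive g t b -> curve_der (fun s => (f s, g s)) t (a, b).
Proof.
  intros Hf Hg eps He.
  assert (He2 : 0 < eps / 2) by lra.
  destruct (proj1 (is_derive_eps _ _ _) Hf _ He2) as [d1 [Hd1 H1]].
  destruct (proj1 (is_derive_eps _ _ _) Hg _ He2) as [d2 [Hd2 H2]].
  exists (Rmin d1 d2). split; [apply Rmin_pos; auto|]. intros s Hs.
  specialize (H1 s (Rlt_le_trans _ _ _ Hs (Rmin_l _ _))).
  specialize (H2 s (Rlt_le_trans _ _ _ Hs (Rmin_r _ _))).
  eapply Rle_trans; [apply Cmod_le_Re_Im|]. simpl.
  match goal with |- Rabs ?x + Rabs ?y <= _ =>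
    replace x with (f s - f t - a * (s - t)) by ring;
    replace y with (g s - g t - b * (s - t)) by ring end.
  lra.
Qed.

Lemma curve_der_comp (f : C -> C) (g : R -> C) (t : R) (l v : C) :
  Cder f (g t) l -> curve_der g t v -> curve_der (fun s => f (g s)) t (l * v).
Proof.
  intros Hf Hg eps He.
  set (K := Cmod v + 1). assert (HK : 1 <= K) by (unfold K; generalize (Cmod_ge_0 v); lra).
  set (L := Cmod l + 1). assert (HL : 1 <= L) by (unfold L; generalize (Cmod_ge_0 l); lra).
  assert (He1 : 0 < eps / 2 / K) by (apply Rdiv_lt_0_compat; lra).
  assert (He2 : 0 < Rmin 1 (eps / 2 / L)) by (apply Rmin_pos; [lra|apply Rdiv_lt_0_compat; lra]).
  destruct (proj1 (Cder_eps _ _ _) Hf _ He1) as [d1 [Hd1 H1]].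
  destruct (Hg _ He2) as [d2 [Hd2 H2]].
  exists (Rmin d2 (d1 / K)). split; [apply Rmin_pos; auto; apply Rdiv_lt_0_compat; lra|].
  intros s Hs.
  specialize (H2 s (Rlt_le_trans _ _ _ Hs (Rmin_l _ _))).
  assert (Hs2 := Rlt_le_trans _ _ _ Hs (Rmin_r _ _)).
  assert (Hr : 0 <= Rabs (s - t)) by apply Rabs_pos.
  set (r := Rabs (s - t)) in *.
  assert (Hm : Cmod (g s - g t) <= K * r).
  { replace (g s - g t)%C with ((g s - g t - v * RtoC (s - t)) + v * RtoC (s - t))%C by ring.
    eapply Rle_trans; [apply Cmod_triangle|]. rewrite Cmod_mult, Cmod_R. fold r.
    assert (Rmin 1 (eps / 2 / L) * r <= 1 * r) by (apply Rmult_le_compat_r; auto; apply Rmin_l).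
    unfold K. lra. }
  assert (Hd : Cmod (g s - g t) < d1).
  { eapply Rle_lt_trans; [apply Hm|]. apply Rmult_lt_compat_l with (r := K) in Hs2; [|lra].
    replace (K * (d1 / K)) with d1 in Hs2 by (field; lra). auto. }
  specialize (H1 (g s) Hd).
  replace (f (g s) - f (g t) - l * v * RtoC (s - t))%C with
    ((f (g s) - f (g t) - l * (g s - g t)) + l * (g s - g t - v * RtoC (s - t)))%C by ring.
  eapply Rle_trans; [apply Cmod_triangle|]. rewrite Cmod_mult.
  assert (eps / 2 / K * Cmod (g s - g t) <= eps / 2 * r).
  { replace (eps / 2 * r) with (eps / 2 / K * (K * r)) by (field; lra).
    apply Rmult_le_compat_l; lra. }
  assert (Cmod l * Cmod (g s - g t - v * RtoC (s - t)) <= eps / 2 * r).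
  { replace (eps / 2 * r) with (L * (eps / 2 / L * r)) by (field; lra).
    apply Rmult_le_compat; try apply Cmod_ge_0. unfold L; lra.
    eapply Rle_trans; [apply H2|]. apply Rmult_le_compat_r; auto. apply Rmin_r. }
  lra.
Qed.

Lemma mean_der (g g' : R -> C) : (forall t, curve_der g t (g' t)) -> curve_cont g' ->
  mean g' = (g 1 - g 0)%C.
Proof.
  intros H Hc. unfold mean.
  assert (HR : is_RInt (fun t => Re (g' t)) 0 1 (minus (Re (g 1)) (Re (g 0)))).
  { apply (is_RInt_derive (V:=R_CompleteNormedModule) (fun t => Re (g t))).
    - intros t _. apply curve_der_Re, H.
    - intros t _. apply (curve_cont_Re g' Hc). }
  assert (HI : is_RInt (fun t => Im (g' t)) 0 1 (minus (Im (g 1)) (Im (g 0)))).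
  { apply (is_RInt_derive (V:=R_CompleteNormedModule) (fun t => Im (g t))).
    - intros t _. apply curve_der_Im, H.
    - intros t _. apply (curve_cont_Im g' Hc). }
  apply (is_RInt_unique (V:=R_CompleteNormedModule)) in HR.
  apply (is_RInt_unique (V:=R_CompleteNormedModule)) in HI.
  rewrite HR, HI. destruct (g 1), (g 0); reflexivity.
Qed.

Lemma RInt_comp_affine (f : R -> R) (u v : R) : (forall t, continuous f t) ->
  u * RInt (fun t => f (u * t + v)) 0 1 = RInt f v (u + v).
Proof.
  intros H.
  assert (E := RInt_comp_lin (V:=R_CompleteNormedModule) f u v 0 1).
  replace (u * 0 + v) with v in E by ring. replace (u * 1 + v) with (u + v) in E by ring.
  rewrite <- E by (apply ex_RInt_cont; auto).
  symmetry. apply RInt_scal_R. intros t. apply (continuous_comp (fun t => u * t + v) f); auto.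
  apply (continuous_plus (V:=R_NormedModule) (fun t => u * t) (fun _ => v)).
  - apply (continuous_scal_r (V:=R_NormedModule) u (fun t => t)). apply continuous_id.
  - apply continuous_const.
Qed.

Lemma mean_halves (g : R -> C) : curve_cont g ->
  mean g = (RtoC (/ 2) * (mean (fun t => g (/ 2 * t + 0)%R) + mean (fun t => g (/ 2 * t + / 2)%R)))%C.
Proof.
  intros H. assert (HR := curve_cont_Re _ H). assert (HI := curve_cont_Im _ H).
  assert (Hh : forall f : R -> R, (forall t, continuous f t) -> RInt f 0 1 =
    / 2 * RInt (fun t => f (/ 2 * t + 0)) 0 1 + / 2 * RInt (fun t => f (/ 2 * t + / 2)) 0 1).
  { intros f Hf. rewrite !RInt_comp_affine by auto.
    replace (/ 2 + 0) with (/ 2) by ring. replace (/ 2 + / 2) with 1 by field.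
    symmetry. apply (RInt_Chasles (V:=R_CompleteNormedModule)); apply ex_RInt_cont; auto. }
  unfold mean. rewrite (Hh _ HR), (Hh _ HI). unfold Cmult, Cplus, RtoC; simpl. f_equal; ring.
Qed.

Lemma mean_rev (g : R -> C) : curve_cont g -> mean (fun t => g (- (1) * t + 1)%R) = mean g.
Proof.
  intros H. assert (HR := curve_cont_Re _ H). assert (HI := curve_cont_Im _ H).
  assert (Hh : forall f : R -> R, (forall t, continuous f t) ->
    RInt (fun t => f (-(1) * t + 1)) 0 1 = RInt f 0 1).
  { intros f Hf. assert (E := RInt_comp_affine f (-(1)) 1 Hf).
    replace (-(1) + 1) with 0 in E by ring.
    assert (S : - RInt f 0 1 = RInt f 1 0).
    { apply (opp_RInt_swap (V:=R_CompleteNormedModule)), ex_RInt_cont; auto. }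
    lra. }
  unfold mean. rewrite (Hh _ HR), (Hh _ HI). reflexivity.
Qed.

Lemma C2_neq0 : RtoC 2 <> 0.
Proof. intro E. injection E. lra. Qed.

Definition lin (a b : C) (t : R) : C := (a + RtoC t * (b - a))%C.

Lemma curve_cont_RtoC : curve_cont RtoC.
Proof. apply (curve_cont_pair (fun t => t) (fun _ => 0)); intros t; [apply continuous_id|apply continuous_const]. Qed.
Lemma curve_cont_lin (a b : C) : curve_cont (lin a b).
Proof.
  apply curve_cont_plus; [apply curve_cont_const|].
  apply curve_cont_mult; [apply curve_cont_RtoC|apply curve_cont_const].
Qed.

Definition seg_int (f : C -> C) (a b : C) : C := ((b - a) * mean (fun t => f (lin a b t)))%C.

Lemma curve_cont_seg (f : C -> C) (a b : C) : (forall z, Ccont f z) -> curve_cont (fun t => f (lin a b t)).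
Proof. intros H. apply curve_cont_comp; auto. apply curve_cont_lin. Qed.

Lemma seg_halves (f : C -> C) (a b : C) : (forall z, Ccont f z) ->
  seg_int f a b = (seg_int f a ((a + b) / 2) + seg_int f ((a + b) / 2) b)%C.
Proof.
  intros H. unfold seg_int. rewrite (mean_halves _ (curve_cont_seg f a b H)).
  rewrite (mean_ext (fun t => f (lin a ((a + b) / 2)%C t)) (fun t => f (lin a b (/ 2 * t + 0)))).
  2:{ intros t. f_equal. unfold lin. rewrite RtoC_plus, RtoC_mult, RtoC_inv by lra. field; apply C2_neq0. }
  rewrite (mean_ext (fun t => f (lin ((a + b) / 2)%C b t)) (fun t => f (lin a b (/ 2 * t + / 2)))).
  2:{ intros t. f_equal. unfold lin. rewrite RtoC_plus, RtoC_mult, RtoC_inv by lra. field; apply C2_neq0. }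
  rewrite RtoC_inv by lra. field; apply C2_neq0.
Qed.

Lemma seg_swap (f : C -> C) (a b : C) : (forall z, Ccont f z) -> seg_int f b a = (- seg_int f a b)%C.
Proof.
  intros H. unfold seg_int. rewrite <- (mean_rev _ (curve_cont_seg f a b H)).
  rewrite (mean_ext (fun t => f (lin b a t)) (fun t => f (lin a b (-(1) * t + 1)))).
  - ring.
  - intros t. f_equal. unfold lin. rewrite RtoC_plus, RtoC_mult, RtoC_opp. ring.
Qed.

Lemma curve_der_lin (a b : C) (t : R) : curve_der (lin a b) t (b - a)%C.
Proof.
  intros eps He. exists 1. split; [lra|]. intros s _. unfold lin.
  rewrite RtoC_minus.
  match goal with |- Cmod ?x <= _ => replace x with (RtoC 0) by ring end.
  rewrite Cmod_0. apply Rmult_le_pos; [lra|apply Rabs_pos].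
Qed.

Lemma seg_der (P f : C -> C) (a b : C) : (forall z, Cder P z (f z)) -> (forall z, Ccont f z) ->
  seg_int f a b = (P b - P a)%C.
Proof.
  intros HP Hf. unfold seg_int.
  rewrite <- (mean_scal _ _ (curve_cont_seg f a b Hf)).
  rewrite (mean_der (fun t => P (lin a b t))).
  - f_equal; [f_equal|do 2 f_equal]; unfold lin; ring.
  - intros t. rewrite Cmult_comm. apply curve_der_comp; [apply HP|apply curve_der_lin].
  - apply curve_cont_mult; [apply curve_cont_const|apply curve_cont_seg; auto].
Qed.

Lemma seg_minus (f g : C -> C) (a b : C) : (forall z, Ccont f z) -> (forall z, Ccont g z) ->
  seg_int (fun z => f z - g z)%C a b = (seg_int f a b - seg_int g a b)%C.
Proof.
  intros Hf Hg. unfold seg_int. rewrite mean_minus by (apply curve_cont_seg; auto). ring.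
Qed.

Lemma Cmod_seg_le (f : C -> C) (a b : C) (M : R) : (forall z, Ccont f z) ->
  (forall t, 0 <= t <= 1 -> Cmod (f (lin a b t)) <= M) -> Cmod (seg_int f a b) <= M * Cmod (b - a).
Proof.
  intros Hf H. unfold seg_int. rewrite Cmod_mult, Rmult_comm. apply Rmult_le_compat_r; [apply Cmod_ge_0|].
  apply Cmod_mean_le; auto. apply curve_cont_seg; auto.
Qed.

(** * Goursat's theorem and primitives *)

Definition holo (f : C -> C) : Prop := forall z, exists l, Cder f z l.

Lemma holo_cont (f : C -> C) : holo f -> forall z, Ccont f z.
Proof. intros H z. destruct (H z) as [l Hl]. eapply Cder_cont, Hl. Qed.

Definition tri_int (f : C -> C) (a b c : C) : C := (seg_int f a b + seg_int f b c + seg_int f c a)%C.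
Definition perimeter (a b c : C) : R := Cmod (b - a) + Cmod (c - b) + Cmod (a - c).

Lemma tri_split (f : C -> C) (a b c : C) : (forall z, Ccont f z) ->
  tri_int f a b c = (tri_int f a ((a + b) / 2) ((c + a) / 2) + tri_int f ((a + b) / 2) b ((b + c) / 2)
    + tri_int f ((c + a) / 2) ((b + c) / 2) c
    + tri_int f ((a + b) / 2) ((b + c) / 2) ((c + a) / 2))%C.
Proof.
  intros H. unfold tri_int.
  rewrite (seg_halves f a b), (seg_halves f b c), (seg_halves f c a) by auto.
  rewrite (seg_swap f ((a + b) / 2) ((c + a) / 2)), (seg_swap f ((b + c) / 2) ((a + b) / 2)),
    (seg_swap f ((c + a) / 2) ((b + c) / 2)) by auto.
  ring.
Qed.

Lemma Cmod_half (x y : C) : y = (x / 2)%C -> Cmod y = Cmod x / 2.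
Proof.
  intros ->. rewrite Cmod_div by apply C2_neq0. rewrite Cmod_R, Rabs_pos_eq by lra. auto.
Qed.

(* One of the four triangles cut out by the midpoints carries a quarter of the integral. *)
Lemma tri_step (f : C -> C) (a b c : C) : (forall z, Ccont f z) -> exists a' b' c',
  Cmod (tri_int f a b c) <= 4 * Cmod (tri_int f a' b' c') /\ perimeter a' b' c' = perimeter a b c / 2 /\
  Cmod (a' - a) <= perimeter a b c.
Proof.
  intros H.
  assert (P1 := Cmod_ge_0 (b - a)). assert (P2 := Cmod_ge_0 (c - b)). assert (P3 := Cmod_ge_0 (a - c)).
  set (t1 := tri_int f a ((a + b) / 2) ((c + a) / 2)).
  set (t2 := tri_int f ((a + b) / 2) b ((b + c) / 2)).
  set (t3 := tri_int f ((c + a) / 2) ((b + c) / 2) c).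
  set (t4 := tri_int f ((a + b) / 2) ((b + c) / 2) ((c + a) / 2)).
  assert (E : Cmod (tri_int f a b c) <= Cmod t1 + Cmod t2 + Cmod t3 + Cmod t4).
  { rewrite tri_split by auto. fold t1 t2 t3 t4.
    generalize (Cmod_triangle (t1 + t2 + t3) t4) (Cmod_triangle (t1 + t2) t3) (Cmod_triangle t1 t2). lra. }
  assert (N2 := C2_neq0).
  assert (HC : Cmod (tri_int f a b c) <= 4 * Cmod t1 \/ Cmod (tri_int f a b c) <= 4 * Cmod t2 \/
    Cmod (tri_int f a b c) <= 4 * Cmod t3 \/ Cmod (tri_int f a b c) <= 4 * Cmod t4) by lra.
  destruct HC as [HC|[HC|[HC|HC]]]; do 3 eexists; (split; [exact HC|]); unfold perimeter; split.
  - rewrite (Cmod_half (b - a) ((a + b) / 2 - a)), (Cmod_half (c - b) ((c + a) / 2 - (a + b) / 2)),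
      (Cmod_half (a - c) (a - (c + a) / 2)) by (field; auto). lra.
  - replace (a - a)%C with (RtoC 0) by ring. rewrite Cmod_0. lra.
  - rewrite (Cmod_half (b - a) (b - (a + b) / 2)), (Cmod_half (c - b) ((b + c) / 2 - b)),
      (Cmod_half (a - c) ((a + b) / 2 - (b + c) / 2)) by (field; auto). lra.
  - rewrite (Cmod_half (b - a) ((a + b) / 2 - a)) by (field; auto). lra.
  - rewrite (Cmod_half (b - a) ((b + c) / 2 - (c + a) / 2)), (Cmod_half (c - b) (c - (b + c) / 2)),
      (Cmod_half (a - c) ((c + a) / 2 - c)) by (field; auto). lra.
  - rewrite Cmod_minus_sym, (Cmod_half (a - c) (a - (c + a) / 2)) by (field; auto). lra.
  - rewrite (Cmod_minus_sym ((b + c) / 2) ((a + b) / 2)), (Cmod_minus_sym ((c + a) / 2) ((b + c) / 2)),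
      (Cmod_minus_sym ((a + b) / 2) ((c + a) / 2)).
    rewrite (Cmod_half (a - c) ((a + b) / 2 - (b + c) / 2)), (Cmod_half (b - a) ((b + c) / 2 - (c + a) / 2)),
      (Cmod_half (c - b) ((c + a) / 2 - (a + b) / 2)) by (field; auto). lra.
  - rewrite (Cmod_half (b - a) ((a + b) / 2 - a)) by (field; auto). lra.
Qed.

Lemma half_pow_pos (n : nat) : 0 < (/ 2) ^ n.
Proof. apply pow_lt. lra. Qed.

Lemma half_pow_small (K d : R) : 0 < d -> exists N, forall n, (N <= n)%nat -> K * (/ 2) ^ n < d.
Proof.
  intros Hd. destruct (pow_lt_1_zero (/ 2)) with (y := d / (Rabs K + 1)) as [N HN].
  - rewrite Rabs_pos_eq; lra.
  - apply Rdiv_lt_0_compat; auto. generalize (Rabs_pos K). lra.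
  - exists N. intros n Hn. specialize (HN n Hn).
    assert (Hp := half_pow_pos n). rewrite Rabs_pos_eq in HN by lra.
    assert (HK := Rabs_pos K). assert (HK' := Rle_abs K).
    apply Rmult_lt_compat_l with (r := Rabs K + 1) in HN; [|lra].
    replace ((Rabs K + 1) * (d / (Rabs K + 1))) with d in HN by (field; lra). nra.
Qed.

(** The ratio 1/2 fits both applications: the nested triangles of [goursat], whose perimeters halve,
    and the iteration in [pair_contraction]. *)
Lemma geometric_limit (u : nat -> C) (K : R) :
  (forall n, Cmod (u (S n) - u n) <= K * (/ 2) ^ n) ->
  exists p, forall n, Cmod (u n - p) <= 2 * K * (/ 2) ^ n.
Proof.
  intros H.
  assert (HK : 0 <= K) by (generalize (H O) (Cmod_ge_0 (u 1%nat - u O)); simpl; lra).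
  assert (Hnk : forall n k, Cmod (u (n + k)%nat - u n) <= 2 * K * (/ 2) ^ n * (1 - (/ 2) ^ k)).
  { intros n k. induction k.
    - rewrite Nat.add_0_r. replace (u n - u n)%C with (RtoC 0) by ring. rewrite Cmod_0. simpl. lra.
    - rewrite Nat.add_succ_r.
      replace (u (S (n + k)) - u n)%C with ((u (S (n + k)) - u (n + k)%nat) + (u (n + k)%nat - u n))%C by ring.
      eapply Rle_trans; [apply Cmod_triangle|]. specialize (H (n + k)%nat).
      rewrite pow_add in H. simpl. lra. }
  assert (Hnm : forall n m, (n <= m)%nat -> Cmod (u m - u n) <= 2 * K * (/ 2) ^ n).
  { intros n m Hm. replace m with (n + (m - n))%nat by lia.
    eapply Rle_trans; [apply Hnk|]. assert (Hp := half_pow_pos n). assert (Hq := half_pow_pos (m - n)).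
    rewrite <- (Rmult_1_r (2 * K * (/ 2) ^ n)) at 2. apply Rmult_le_compat_l; [|lra].
    apply Rmult_le_pos; lra. }
  assert (Hc : forall g : C -> R, (forall x y : C, Rabs (g x - g y) <= Cmod (x - y)) ->
    exists l, Un_cv (fun n => g (u n)) l).
  { intros g Hg. destruct (Rcomplete.R_complete (fun n => g (u n))) as [l Hl]; [|exists l; auto].
    intros eps He. destruct (half_pow_small (2 * K) (eps / 2)) as [N HN]; [lra|].
    exists N. intros n m Hn Hm. unfold Rdist.
    specialize (HN N (le_n _)).
    assert (H1 := Hg (u n) (u N)). assert (H2 := Hg (u m) (u N)).
    assert (H3 := Hnm N n Hn). assert (H4 := Hnm N m Hm).
    replace (g (u n) - g (u m)) with ((g (u n) - g (u N)) - (g (u m) - g (u N))) by ring.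
    unfold Rminus at 1. eapply Rle_lt_trans; [apply Rabs_triang|]. rewrite Rabs_Ropp. lra. }
  destruct (Hc Re) as [x Hx].
  { intros. apply (re_le_Cmod (x - y)%C). }
  destruct (Hc Im) as [y Hy].
  { intros. apply (im_le_Cmod (x0 - y)%C). }
  exists (x, y). intros n. apply le_epsilon. intros eps He.
  destruct (Hx (eps / 2)) as [N1 H1]; [lra|]. destruct (Hy (eps / 2)) as [N2 H2]; [lra|].
  set (m := (n + (N1 + N2))%nat).
  assert (Hm : Cmod (u m - (x, y)) <= eps).
  { eapply Rle_trans; [apply Cmod_le_Re_Im|].
    assert (A1 : (m >= N1)%nat) by (unfold m; lia). assert (A2 : (m >= N2)%nat) by (unfold m; lia).
    specialize (H1 m A1). specialize (H2 m A2). unfold Rdist in *.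
    change (Rabs (Re (u m) - x) + Rabs (Im (u m) - y) <= eps). lra. }
  assert (Hn : Cmod (u m - u n) <= 2 * K * (/ 2) ^ n) by (apply Hnm; unfold m; lia).
  replace (u n - (x, y))%C with ((u m - (x, y)) - (u m - u n))%C by ring.
  eapply Rle_trans; [apply Cmod_triangle|]. rewrite Cmod_opp. lra.
Qed.

Lemma Cmod_lin_le (a b : C) (t : R) : 0 <= t <= 1 -> Cmod (lin a b t - a) <= Cmod (b - a).
Proof.
  intros Ht. unfold lin. replace (a + RtoC t * (b - a) - a)%C with (RtoC t * (b - a))%C by ring.
  rewrite Cmod_mult, Cmod_R, Rabs_pos_eq by lra.
  generalize (Cmod_ge_0 (b - a)). nra.
Qed.

(** Subdivision at midpoints. As [f] is differentiable in the whole plane, the limit point [p] need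
    not be located inside the triangles: it suffices that the first vertices converge to it at the
    rate at which the triangles shrink. *)
Theorem goursat (f : C -> C) (a b c : C) : holo f -> tri_int f a b c = 0.
Proof.
  intros Hf. assert (Hc := holo_cont f Hf).
  set (T := (C * C * C)%type).
  set (tr := fun t : T => tri_int f (fst (fst t)) (snd (fst t)) (snd t)).
  set (pr := fun t : T => perimeter (fst (fst t)) (snd (fst t)) (snd t)).
  assert (Hstep : forall t : T, exists t' : T, Cmod (tr t) <= 4 * Cmod (tr t') /\ pr t' = pr t / 2 /\
    Cmod (fst (fst t') - fst (fst t)) <= pr t).
  { intros [[x y] z]. destruct (tri_step f x y z Hc) as (x' & y' & z' & H).
    exists (x', y', z'). exact H. }
  apply choice in Hstep. destruct Hstep as [next Hnext].
  set (t := fun n => Nat.iter n next (a, b, c)).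
  assert (Ht : forall n, t (S n) = next (t n)) by reflexivity.
  assert (Hpr : forall n, pr (t n) = perimeter a b c * (/ 2) ^ n).
  { induction n. simpl. unfold pr, t; simpl. ring.
    rewrite Ht. destruct (Hnext (t n)) as (_ & -> & _). rewrite IHn. simpl. field. }
  assert (Htr : forall n, Cmod (tri_int f a b c) * ((/ 2) ^ n * (/ 2) ^ n) <= Cmod (tr (t n))).
  { induction n. simpl. unfold tr, t; simpl. lra.
    rewrite Ht. destruct (Hnext (t n)) as (H & _ & _). simpl. lra. }
  destruct (geometric_limit (fun n => fst (fst (t n))) (perimeter a b c)) as [p Hp].
  { intros n. rewrite Ht, <- Hpr. apply Hnext. }
  set (L := perimeter a b c) in *.
  assert (HL : 0 <= L) by (unfold L, perimeter; generalize (Cmod_ge_0 (b - a)) (Cmod_ge_0 (c - b)) (Cmod_ge_0 (a - c)); lra).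
  destruct (Hf p) as [l Hl].
  (* The first-order approximation of [f] at [p] has a primitive, so only the remainder [f - g]
     contributes to the integral over a small triangle. *)
  set (g := fun z => (f p + l * (z - p))%C).
  assert (Hg : holo g).
  { intros z. exists (0 + l * (1 - 0))%C. apply Cder_plus; [apply Cder_const|].
    apply Cder_scal, Cder_minus; [apply Cder_id|apply Cder_const]. }
  assert (Hgc := holo_cont g Hg).
  assert (Hg0 : forall x y z, tri_int g x y z = 0).
  { set (P := fun z => (f p * z + l / 2 * ((z - p) * (z - p)))%C).
    assert (HP : forall z, Cder P z (g z)).
    { intros z. unfold P, g.
      replace (f p + l * (z - p))%C with (f p * 1 + l / 2 * ((1 - 0) * (z - p) + (z - p) * (1 - 0)))%C.
      2:{ field; apply C2_neq0. }
      assert (Cder (fun z => z - p) z (1 - 0))%C by (apply Cder_minus; [apply Cder_id|apply Cder_const]).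
      apply Cder_plus.
      - apply Cder_scal. apply Cder_id.
      - apply Cder_scal. apply (Cder_mult (fun z => z - p) (fun z => z - p))%C; auto. }
    intros x y z. unfold tri_int. rewrite !(seg_der P g) by auto. ring. }
  assert (Hm : forall eps, 0 < eps -> Cmod (tri_int f a b c) <= 4 * L * L * eps).
  { intros eps He. destruct (proj1 (Cder_eps _ _ _) Hl eps He) as [d [Hd Hdd]].
    destruct (half_pow_small (4 * L) d Hd) as [N HN]. specialize (HN N (le_n _)).
    assert (Hq := half_pow_pos N). set (q := (/ 2) ^ N) in *.
    specialize (Hpr N). specialize (Htr N). specialize (Hp N). fold q in Hpr, Htr, Hp.
    destruct (t N) as [[x y] z]. unfold pr in Hpr; unfold tr in Htr; simpl in Hpr, Htr, Hp.
    (* The perimeter is [L * q]; one half of [4 * L * q] is the distance from [w] to [x], the other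
       the distance from [x] to [p]. *)
    assert (Hb : forall w, Cmod (w - x) <= 2 * perimeter x y z -> Cmod (f w - g w) <= eps * (4 * L * q)).
    { intros w Hw.
      assert (Hwp : Cmod (w - p) <= 4 * L * q).
      { replace (w - p)%C with ((w - x) + (x - p))%C by ring. eapply Rle_trans; [apply Cmod_triangle|].
        rewrite Hpr in Hw. lra. }
      unfold g. replace (f w - (f p + l * (w - p)))%C with (f w - f p - l * (w - p))%C by ring.
      eapply Rle_trans; [apply Hdd; lra|]. apply Rmult_le_compat_l; lra. }
    assert (P1 := Cmod_ge_0 (y - x)). assert (P2 := Cmod_ge_0 (z - y)). assert (P3 := Cmod_ge_0 (x - z)).
    assert (Hs : forall u v, Cmod (v - u) + Cmod (u - x) <= 2 * perimeter x y z ->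
      Cmod (seg_int (fun w => f w - g w)%C u v) <= eps * (4 * L * q) * Cmod (v - u)).
    { intros u v Huv. apply Cmod_seg_le.
      - intros w. apply holo_cont. intros w0. destruct (Hf w0) as [l1 H1]. destruct (Hg w0) as [l2 H2].
        exists (l1 - l2)%C. apply Cder_minus; auto.
      - intros s Hs. apply Hb. replace (lin u v s - x)%C with ((lin u v s - u) + (u - x))%C by ring.
        eapply Rle_trans; [apply Cmod_triangle|]. generalize (Cmod_lin_le u v s Hs). lra. }
    assert (E : tri_int f x y z = (seg_int (fun w => f w - g w) x y + seg_int (fun w => f w - g w) y z + seg_int (fun w => f w - g w) z x)%C).
    { rewrite !seg_minus by auto. specialize (Hg0 x y z). unfold tri_int in *.
      transitivity (seg_int f x y + seg_int f y z + seg_int f z x - (seg_int g x y + seg_int g y z + seg_int g z x))%C.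
      rewrite Hg0; ring. ring. }
    assert (S1 := Hs x y). assert (S2 := Hs y z). assert (S3 := Hs z x).
    replace (x - x)%C with (RtoC 0) in S1 by ring. rewrite Cmod_0 in S1.
    rewrite (Cmod_minus_sym z x) in S3.
    assert (Cmod (tri_int f x y z) <= eps * (4 * L * q) * (L * q)).
    { rewrite <- Hpr. rewrite E. unfold perimeter in *.
      eapply Rle_trans; [apply Cmod_triangle|]. eapply Rle_trans; [apply Rplus_le_compat_r, Cmod_triangle|].
      assert (S1' := S1 ltac:(lra)). assert (S2' := S2 ltac:(lra)). assert (S3' := S3 ltac:(lra)). lra. }
    assert (Hqq : 0 < q * q) by nra.
    apply Rmult_le_reg_r with (q * q); auto. eapply Rle_trans; [apply Htr|].
    eapply Rle_trans; [apply H|]. lra. }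
  apply Cmod_eq_0. apply Rle_antisym; [|apply Cmod_ge_0].
  apply le_epsilon. intros eps He. rewrite Rplus_0_l.
  assert (HLL : 0 <= 4 * L * L) by nra.
  eapply Rle_trans; [apply (Hm (eps / (4 * L * L + 1)))|].
  - apply Rdiv_lt_0_compat; lra.
  - replace eps with ((4 * L * L + 1) * (eps / (4 * L * L + 1))) at 2 by (field; lra).
    apply Rmult_le_compat_r; [|lra]. left. apply Rdiv_lt_0_compat; lra.
Qed.

(** Integrate from 0 along segments. By Goursat's theorem the increment from [z] to [w] is the
    integral over the segment between them, and continuity of [f] at [z] gives the derivative. *)
Theorem holo_primitive (f : C -> C) : holo f -> exists P, forall z, Cder P z (f z).
Proof.
  intros Hf. assert (Hc := holo_cont f Hf).
  exists (fun z => seg_int f 0 z). intros z. apply Cder_eps. intros eps He.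
  destruct (proj1 (Ccont_eps _ _) (Hc z) eps He) as [d [Hd H]].
  exists d; split; auto. intros w Hw.
  assert (E := goursat f 0 z w Hf). unfold tri_int in E. rewrite (seg_swap f 0 w) in E by auto.
  replace (seg_int f 0 w - seg_int f 0 z)%C with (seg_int f z w).
  2:{ transitivity (seg_int f 0 w - seg_int f 0 z + (seg_int f 0 z + seg_int f z w + - seg_int f 0 w))%C; [ring|rewrite E; ring]. }
  replace (f z * (w - z))%C with (seg_int (fun _ => f z) z w).
  2:{ unfold seg_int. rewrite mean_const. ring. }
  assert (Hk : forall x, Ccont (fun _ => f z) x) by (intros x; eapply Cder_cont, Cder_const).
  rewrite <- seg_minus by auto. apply Cmod_seg_le.
  - intros x. apply holo_cont. intros y. destruct (Hf y) as [l Hl]. exists (l - 0)%C.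
    apply Cder_minus; auto. apply Cder_const.
  - intros t Ht. left. apply H. eapply Rle_lt_trans; [apply Cmod_lin_le; auto|]. auto.
Qed.

(** * Cauchy's formula on the unit circle *)

Lemma Cder_ext_loc (f g : C -> C) (z l : C) (d : R) : 0 < d ->
  (forall w, Cmod (w - z) < d -> f w = g w) -> Cder f z l -> Cder g z l.
Proof.
  intros Hd H. apply is_derive_ext_loc. apply locally_CV. exists d; auto.
Qed.

Lemma Cder_unique (f : C -> C) (z l l' : C) : Cder f z l -> Cder f z l' -> l = l'.
Proof.
  intros H H'.
  assert (E : Cmod (l - l') <= 0).
  { apply le_epsilon. intros eps He.
    destruct (proj1 (Cder_eps _ _ _) H (eps / 2)) as [d [Hd Hl]]; [lra|].
    destruct (proj1 (Cder_eps _ _ _) H' (eps / 2)) as [d' [Hd' Hl']]; [lra|].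
    set (h := Rmin d d' / 2).
    assert (Hh : 0 < h) by (unfold h; generalize (Rmin_pos _ _ Hd Hd'); lra).
    assert (h < d) by (unfold h in *; generalize (Rmin_l d d'); lra).
    assert (h < d') by (unfold h in *; generalize (Rmin_r d d'); lra).
    assert (Hm : Cmod (z + RtoC h - z) = h).
    { replace (z + RtoC h - z)%C with (RtoC h) by ring. rewrite Cmod_R, Rabs_pos_eq; lra. }
    specialize (Hl (z + RtoC h)%C). specialize (Hl' (z + RtoC h)%C). rewrite Hm in *.
    specialize (Hl ltac:(lra)). specialize (Hl' ltac:(lra)).
    assert (Hx : Cmod (l - l') * h <= eps * h).
    { replace (Cmod (l - l') * h) with (Cmod ((l - l') * RtoC h)).
      2:{ rewrite Cmod_mult, Cmod_R, (Rabs_pos_eq h); lra. }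
      replace ((l - l') * RtoC h)%C with
        ((f (z + RtoC h) - f z - l' * (z + RtoC h - z)) - (f (z + RtoC h) - f z - l * (z + RtoC h - z)))%C by ring.
      eapply Rle_trans; [apply Cmod_triangle|]. rewrite Cmod_opp. lra. }
    apply Rmult_le_reg_r in Hx; lra. }
  assert (E0 : (l - l')%C = 0) by (apply Cmod_eq_0, Rle_antisym; auto; apply Cmod_ge_0).
  replace l with (l - l' + l')%C by ring. rewrite E0. ring.
Qed.

Lemma holo_const (c : C) : holo (fun _ => c).
Proof. intros z. eexists. apply Cder_const. Qed.
Lemma holo_id : holo (fun z => z).
Proof. intros z. eexists. apply Cder_id. Qed.
Lemma holo_plus (f g : C -> C) : holo f -> holo g -> holo (fun z => f z + g z)%C.
Proof. intros Hf Hg z. destruct (Hf z), (Hg z). eexists. apply Cder_plus; eauto. Qed.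
Lemma holo_minus (f g : C -> C) : holo f -> holo g -> holo (fun z => f z - g z)%C.
Proof. intros Hf Hg z. destruct (Hf z), (Hg z). eexists. apply Cder_minus; eauto. Qed.
Lemma holo_mult (f g : C -> C) : holo f -> holo g -> holo (fun z => f z * g z)%C.
Proof. intros Hf Hg z. destruct (Hf z), (Hg z). eexists. apply Cder_mult; eauto. Qed.
Lemma holo_comp (f g : C -> C) : holo f -> holo g -> holo (fun z => f (g z)).
Proof. intros Hf Hg z. destruct (Hg z) as [a Ha]. destruct (Hf (g z)) as [b Hb]. eexists. apply Cder_comp; eauto. Qed.
Lemma holo_pow (n : nat) : holo (fun z => z ^ n)%C.
Proof. induction n; simpl. apply holo_const. apply holo_mult; auto. apply holo_id. Qed.

(** The second-order remainder of [P] is the integral of the first-order remainder of [f] along the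
    segment from [c] to [z]. *)
Lemma peano2 (P f : C -> C) (c l : C) : (forall z, Cder P z (f z)) -> holo f -> Cder f c l ->
  forall eps, 0 < eps -> exists d, 0 < d /\ forall z, Cmod (z - c) < d ->
    Cmod (P z - P c - f c * (z - c) - l / 2 * ((z - c) * (z - c))) <= eps * (Cmod (z - c) * Cmod (z - c)).
Proof.
  intros HP Hf Hl eps He.
  destruct (proj1 (Cder_eps _ _ _) Hl eps He) as [d [Hd H]]. exists d; split; auto.
  intros z Hz.
  set (E := fun w => (P w - (f c * w + l / 2 * ((w - c) * (w - c))))%C).
  set (E' := fun w => (f w - (f c + l * (w - c)))%C).
  assert (HE : forall w, Cder E w (E' w)).
  { intros w. unfold E, E'.
    replace (f c + l * (w - c))%C with (f c * 1 + l / 2 * ((1 - 0) * (w - c) + (w - c) * (1 - 0)))%C.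
    2:{ field; apply C2_neq0. }
    assert (Cder (fun z => z - c) w (1 - 0))%C by (apply Cder_minus; [apply Cder_id|apply Cder_const]).
    apply Cder_minus; auto. apply Cder_plus.
    - apply Cder_scal, Cder_id.
    - apply Cder_scal, (Cder_mult (fun z => z - c) (fun z => z - c))%C; auto. }
  assert (HEc : forall w, Ccont E' w).
  { apply holo_cont. unfold E'. apply holo_minus; auto. apply holo_plus. apply holo_const.
    apply holo_mult. apply holo_const. apply holo_minus. apply holo_id. apply holo_const. }
  assert (S := seg_der E E' c z HE HEc).
  replace (P z - P c - f c * (z - c) - l / 2 * ((z - c) * (z - c)))%C with (E z - E c)%C by (unfold E; ring).
  rewrite <- S, <- Rmult_assoc. apply Cmod_seg_le; auto.
  intros t Ht. unfold E'. assert (Hlin := Cmod_lin_le c z t Ht).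
  replace (f (lin c z t) - (f c + l * (lin c z t - c)))%C with (f (lin c z t) - f c - l * (lin c z t - c))%C by ring.
  eapply Rle_trans; [apply H; lra|]. apply Rmult_le_compat_l; lra.
Qed.

(* The divided difference is differentiable at [c] itself because [P] is twice differentiable
   there; this avoids Goursat's theorem with an exceptional point. *)
Lemma primitive_divided_difference (P f : C -> C) (c : C) : (forall z, Cder P z (f z)) -> holo f ->
  exists q, holo q /\ forall z, (P z - P c = (z - c) * q z)%C.
Proof.
  intros HP Hf.
  exists (fun z => if excluded_middle_informative (z = c) then f c else ((P z - P c) / (z - c))%C).
  assert (Hnz : forall z, z <> c -> (z - c)%C <> 0).
  { intros z Hz E. apply Hz. replace z with (z - c + c)%C by ring. rewrite E. ring. }
  split.
  - intros z. destruct (excluded_middle_informative (z = c)) as [->|Hz].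
    + destruct (Hf c) as [l Hl]. exists (l / 2)%C. apply Cder_eps. intros eps He.
      destruct (peano2 P f c l HP Hf Hl eps He) as [d [Hd H]]. exists d; split; auto.
      intros w Hw. destruct (excluded_middle_informative (c = c)) as [_|]; [|tauto].
      destruct (excluded_middle_informative (w = c)) as [->|Hwc].
      * replace (f c - f c - l / 2 * (c - c))%C with (RtoC 0) by ring. rewrite Cmod_0.
        apply Rmult_le_pos; [lra|apply Cmod_ge_0].
      * specialize (H w Hw). assert (Hm : 0 < Cmod (w - c)) by (apply Cmod_gt_0; auto).
        apply Rmult_le_reg_r with (Cmod (w - c)); auto. rewrite Rmult_assoc.
        eapply Rle_trans; [|apply H]. rewrite <- Cmod_mult. right. f_equal. field; auto.
    + eexists.
      apply Cder_ext_loc with (f := fun w => ((P w - P c) * / (w - c))%C) (d := Cmod (z - c)).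
      * apply Cmod_gt_0; auto.
      * intros w Hw. destruct (excluded_middle_informative (w = c)) as [->|]; auto.
        exfalso. rewrite Cmod_minus_sym in Hw. lra.
      * apply Cder_mult.
        -- apply Cder_minus; [apply HP|apply Cder_const].
        -- apply (Cder_comp Cinv (fun w => w - c)%C); [apply Cder_inv; auto|].
           apply Cder_minus; [apply Cder_id|apply Cder_const].
  - intros z. destruct (excluded_middle_informative (z = c)) as [->|Hz].
    + ring.
    + field; auto.
Qed.

Lemma Cmult_eq_reg_l (a x y : C) : a <> 0 -> (a * x = a * y)%C -> x = y.
Proof.
  intros Ha E. replace x with (/ a * (a * x))%C by (field; auto). rewrite E. field; auto.
Qed.

Definition circ (t : R) : C := (cos (2 * PI * t), sin (2 * PI * t)).

Lemma Cmod_circ (t : R) : Cmod (circ t) = 1.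
Proof.
  unfold Cmod, circ; simpl. rewrite !Rmult_1_r.
  replace (_ + _) with 1. apply sqrt_1.
  generalize (sin2_cos2 (2 * PI * t)). unfold Rsqr. lra.
Qed.
Lemma circ_neq0 (t : R) : circ t <> 0.
Proof. apply Cmod_gt_0. rewrite Cmod_circ. lra. Qed.
Lemma circ_conj (t : R) : (circ t * Cconj (circ t))%C = 1.
Proof. rewrite <- Cmod2_conj, Cmod_circ. f_equal. ring. Qed.

Lemma curve_der_circ (t : R) : curve_der circ t (2 * PI * Ci * circ t)%C.
Proof.
  replace (2 * PI * Ci * circ t)%C with (- (2 * PI * sin (2 * PI * t)), 2 * PI * cos (2 * PI * t)).
  2:{ unfold circ, Ci, RtoC, Cmult; simpl. f_equal; ring. }
  apply curve_der_pair; auto_derive; auto; ring.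
Qed.
Lemma curve_cont_circ : curve_cont circ.
Proof.
  apply curve_cont_pair; intros t; apply (ex_derive_continuous (K:=R_AbsRing) (V:=R_NormedModule)); auto_derive; auto.
Qed.
Lemma curve_cont_holo_circ (f : C -> C) : holo f -> curve_cont (fun t => f (circ t)).
Proof. intros H. apply curve_cont_comp; [apply curve_cont_circ|]. intros; apply holo_cont; auto. Qed.

(** Cauchy's theorem for the unit circle: up to the factor [2 * PI * Ci] the mean is the contour
    integral of [q], which has a primitive, and the curve is closed. *)
Lemma mean_circ_zero (q : C -> C) : holo q -> mean (fun t => q (circ t) * circ t)%C = 0.
Proof.
  intros Hq. destruct (holo_primitive q Hq) as [Q HQ].
  assert (Hc : curve_cont (fun t => q (circ t) * circ t)%C).
  { apply curve_cont_mult; [apply curve_cont_holo_circ; auto|apply curve_cont_circ]. }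
  assert (H2 : (2 * PI * Ci)%C <> 0).
  { apply Cmod_gt_0. rewrite !Cmod_mult, Cmod_Ci, !Cmod_R, !Rabs_pos_eq; generalize PI_RGT_0; lra. }
  assert (E : (2 * PI * Ci * mean (fun t => q (circ t) * circ t) = 0)%C).
  { rewrite <- mean_scal by auto.
    rewrite (mean_der (fun t => Q (circ t))).
    - unfold circ. rewrite Rmult_1_r, Rmult_0_r, sin_0, cos_0, sin_2PI, cos_2PI. ring.
    - intros t. replace (2 * PI * Ci * (q (circ t) * circ t))%C with (q (circ t) * (2 * PI * Ci * circ t))%C by ring.
      apply curve_der_comp; [apply HQ|apply curve_der_circ].
    - apply curve_cont_mult; [apply curve_cont_const|auto]. }
  apply (Cmult_eq_reg_l (2 * PI * Ci)); auto. rewrite E. ring.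
Qed.

Lemma curve_bounded (g : R -> C) : curve_cont g -> exists M, 0 <= M /\ forall t, 0 <= t <= 1 -> Cmod (g t) <= M.
Proof.
  intros H.
  assert (Hb : forall f : R -> R, (forall t, continuous f t) -> exists M, forall t, 0 <= t <= 1 -> f t <= M).
  { intros f Hf. destruct (continuity_ab_maj f 0 1) as [m [Hm _]]; [lra| |].
    - intros t _. apply continuity_pt_filterlim, Hf.
    - exists (f m). auto. }
  assert (HR := curve_cont_Re _ H). assert (HI := curve_cont_Im _ H).
  destruct (Hb _ (fun t => continuous_comp _ Rabs t (HR t) (continuous_Rabs _))) as [M1 H1].
  destruct (Hb _ (fun t => continuous_comp _ Rabs t (HI t) (continuous_Rabs _))) as [M2 H2].
  exists (Rabs M1 + Rabs M2). split; [generalize (Rabs_pos M1) (Rabs_pos M2); lra|].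
  intros t Ht. eapply Rle_trans; [apply Cmod_le_Re_Im|].
  specialize (H1 t Ht). specialize (H2 t Ht).
  generalize (Rle_abs M1) (Rle_abs M2). lra.
Qed.

Lemma Cminus_neq0_lt (x y : C) : Cmod x < Cmod y -> (y - x)%C <> 0.
Proof. intros H. apply Cmod_gt_0. generalize (Cmod_triangle_rev y x). lra. Qed.

Lemma Cmod_le_zero_pow (x : C) (K r : R) : 0 <= r < 1 -> (forall n, Cmod x <= K * r ^ n) -> x = 0.
Proof.
  intros Hr H. apply Cmod_eq_0, Rle_antisym; [|apply Cmod_ge_0].
  apply le_epsilon. intros eps He. rewrite Rplus_0_l.
  assert (HK : 0 <= K) by (generalize (H O) (Cmod_ge_0 x); simpl; lra).
  destruct (pow_lt_1_zero r) with (y := eps / (K + 1)) as [N HN].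
  - rewrite Rabs_pos_eq; lra.
  - apply Rdiv_lt_0_compat; lra.
  - specialize (HN N (le_n _)). specialize (H N).
    assert (Hp : 0 <= r ^ N) by (apply pow_le; lra). rewrite Rabs_pos_eq in HN by auto.
    apply Rmult_lt_compat_l with (r := K + 1) in HN; [|lra].
    replace ((K + 1) * (eps / (K + 1))) with eps in HN by (field; lra). nra.
Qed.

(* Expanding the geometric series, every term but the first has mean zero. *)
Lemma mean_circ_geom (G : C -> C) (w : C) : holo G -> mean (fun t => G (circ t)) = G 0 ->
  Cmod w < 1 -> mean (fun t => G (circ t) * / (1 - w * circ t))%C = G 0.
Proof.
  intros HG H0 Hw.
  assert (HGc := curve_cont_holo_circ G HG).
  assert (Hwc : curve_cont (fun t => w * circ t)%C).
  { apply curve_cont_mult; [apply curve_cont_const|apply curve_cont_circ]. }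
  assert (Hm : forall t, Cmod (w * circ t) = Cmod w) by (intros t; rewrite Cmod_mult, Cmod_circ; ring).
  assert (Hnz : forall t, (1 - w * circ t)%C <> 0).
  { intros t. apply Cminus_neq0_lt. rewrite Hm, Cmod_1. auto. }
  assert (Hpc : forall n, curve_cont (fun t => (w * circ t) ^ n)%C).
  { intros n. apply (curve_cont_comp (fun z => z ^ n)%C _ Hwc). intros; apply holo_cont, holo_pow. }
  assert (Hic : curve_cont (fun t => / (1 - w * circ t))%C).
  { apply curve_cont_inv; auto. apply curve_cont_minus; auto. apply curve_cont_const. }
  (* [A n] is the remainder of the geometric series from the [n]-th term on. All remainders with
     [n >= 1] agree because the terms between them have mean zero, and they tend to 0. *)
  set (A := fun n => mean (fun t => G (circ t) * (w * circ t) ^ n * / (1 - w * circ t))%C).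
  assert (HA : forall n, A n = (mean (fun t => G (circ t) * (w * circ t) ^ n)%C + A (S n))%C).
  { intros n. unfold A. rewrite <- mean_plus.
    - apply mean_ext. intros t. simpl. field; auto.
    - apply curve_cont_mult; auto.
    - apply curve_cont_mult; auto. apply curve_cont_mult; auto. }
  assert (HS : forall n, mean (fun t => G (circ t) * (w * circ t) ^ S n)%C = 0).
  { intros n.
    rewrite (mean_ext _ (fun t => (fun z => G z * (w * (w * z) ^ n))%C (circ t) * circ t)%C).
    - apply (mean_circ_zero (fun z => G z * (w * (w * z) ^ n))%C).
      apply holo_mult; auto. apply holo_mult. apply holo_const.
      apply (holo_comp (fun z => z ^ n)%C (fun z => w * z)%C). apply holo_pow.
      apply holo_mult. apply holo_const. apply holo_id.
    - intros t. simpl. ring. }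
  assert (HA1 : A 1%nat = 0).
  { destruct (curve_bounded _ HGc) as [M [HM0 HM]].
    assert (HAn : forall n, A (S n) = A 1%nat).
    { induction n; auto. rewrite <- IHn, (HA (S n)), HS. ring. }
    apply (Cmod_le_zero_pow _ (M * Cmod w * / (1 - Cmod w)) (Cmod w)).
    - split; auto. apply Cmod_ge_0.
    - intros n. rewrite <- (HAn n). unfold A. apply Cmod_mean_le.
      + apply curve_cont_mult; auto. apply curve_cont_mult; auto.
      + intros t Ht. rewrite !Cmod_mult, Cmod_pow, Hm, Cmod_inv by auto.
        assert (Hi : / Cmod (1 - w * circ t) <= / (1 - Cmod w)).
        { apply Rinv_le_contravar; [lra|]. generalize (Cmod_triangle_rev 1 (w * circ t)). rewrite Hm, Cmod_1. auto. }
        assert (Hp : 0 <= Cmod w * Cmod w ^ n) by (apply (pow_le _ (S n)), Cmod_ge_0).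
        assert (0 <= / (1 - Cmod w)) by (left; apply Rinv_0_lt_compat; lra).
        replace (M * Cmod w * / (1 - Cmod w) * Cmod w ^ n) with (M * (Cmod w * Cmod w ^ n) * / (1 - Cmod w)) by ring.
        simpl. apply Rmult_le_compat; auto.
        * apply Rmult_le_pos; auto. apply Cmod_ge_0.
        * left. apply Rinv_0_lt_compat, Cmod_gt_0, Hnz.
        * apply Rmult_le_compat_r; auto. }
  transitivity (A 0%nat).
  - apply mean_ext. intros t. simpl. ring.
  - rewrite HA, HA1, <- H0. rewrite Cplus_0_r. apply mean_ext. intros t. simpl. ring.
Qed.

(** On the unit circle the inverse is the conjugate. So the Cauchy kernel is the conjugate of a
    geometric series in nonnegative powers of [circ t], and [mean_circ_geom] gives its mean without
    any winding number. *)
Lemma circ_kernel (w : C) (t : R) : Cmod w < 1 ->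
  (circ t * / (circ t - w))%C = Cconj (/ (1 - Cconj w * circ t))%C.
Proof.
  intros Hw. assert (H1 := circ_conj t). assert (H0 := circ_neq0 t).
  assert (Hn : (circ t - w)%C <> 0) by (apply Cminus_neq0_lt; rewrite Cmod_circ; auto).
  assert (Hn' : (1 - Cconj w * circ t)%C <> 0).
  { apply Cminus_neq0_lt. rewrite Cmod_mult, Cmod_conj, Cmod_circ, Cmod_1. lra. }
  assert (Hc : forall z : C, z <> 0 -> Cconj (/ z)%C = (/ Cconj z)%C).
  { intros z Hz. apply (Cmult_eq_reg_l (Cconj z)).
    - intros E. apply Hz. apply Cmod_eq_0. rewrite <- Cmod_conj, E. apply Cmod_0.
    - rewrite <- Cmult_conj, Cinv_r, Cinv_r; auto.
      + unfold Cconj, RtoC; simpl. f_equal; ring.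
      + intros E. apply Hz. apply Cmod_eq_0. rewrite <- Cmod_conj, E. apply Cmod_0. }
  rewrite Hc by auto. rewrite Cminus_conj, Cmult_conj, Cconj_conj.
  replace (Cconj 1) with (RtoC 1) by (unfold Cconj, RtoC; simpl; f_equal; ring).
  rewrite <- H1.
  replace (circ t * Cconj (circ t) - w * Cconj (circ t))%C with ((circ t - w) * Cconj (circ t))%C by ring.
  assert (Hcc : Cconj (circ t) <> 0).
  { apply Cmod_gt_0. rewrite Cmod_conj, Cmod_circ. lra. }
  apply (Cmult_eq_reg_l ((circ t - w) * Cconj (circ t))).
  - apply Cmult_neq_0; auto.
  - rewrite Cinv_r by (apply Cmult_neq_0; auto). rewrite <- H1. field; auto.
Qed.

Lemma curve_cont_kernel (w : C) : Cmod w < 1 -> curve_cont (fun t => / (circ t - w))%C.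
Proof.
  intros Hw. apply curve_cont_inv.
  - apply curve_cont_minus; [apply curve_cont_circ|apply curve_cont_const].
  - intros t. apply Cminus_neq0_lt. rewrite Cmod_circ; auto.
Qed.

Lemma curve_cont_conj (f : R -> C) : curve_cont f -> curve_cont (fun t => Cconj (f t)).
Proof.
  intros H. apply (curve_cont_pair (fun t => Re (f t)) (fun t => - Im (f t))).
  - apply curve_cont_Re; auto.
  - intros t. apply (continuous_opp (V:=R_NormedModule) (fun t => Im (f t))). apply (curve_cont_Im f H).
Qed.

Lemma mean_kernel (w : C) : Cmod w < 1 -> mean (fun t => circ t * / (circ t - w))%C = 1.
Proof.
  intros Hw. rewrite (mean_ext _ _ (fun t => circ_kernel w t Hw)).
  assert (Hw' : Cmod (Cconj w) < 1) by (rewrite Cmod_conj; auto).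
  rewrite mean_conj.
  - rewrite (mean_ext _ (fun t => 1 * / (1 - Cconj w * circ t))%C).
    + rewrite (mean_circ_geom (fun _ => 1)); auto.
      * unfold Cconj, RtoC; simpl. f_equal; ring.
      * apply holo_const.
      * apply mean_const.
    + intros t. ring.
  - apply curve_cont_inv.
    + apply curve_cont_minus; [apply curve_cont_const|].
      apply curve_cont_mult; [apply curve_cont_const|apply curve_cont_circ].
    + intros t. apply Cminus_neq0_lt. rewrite Cmod_mult, Cmod_circ, Cmod_1. lra.
Qed.

(* Only primitives of entire functions are covered so far, since the divided difference needs a
   second derivative; [cauchy] removes this restriction. *)
Lemma cauchy_primitive (P f : C -> C) (w : C) : (forall z, Cder P z (f z)) -> holo f -> Cmod w < 1 ->
  P w = mean (fun t => P (circ t) * (circ t * / (circ t - w)))%C.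
Proof.
  intros HP Hf Hw.
  destruct (primitive_divided_difference P f w HP Hf) as [q [Hq HPq]].
  rewrite (mean_ext _ (fun t => P w * (circ t * / (circ t - w)) + q (circ t) * circ t)%C).
  - rewrite mean_plus, mean_scal, mean_kernel, mean_circ_zero; auto.
    + ring.
    + apply curve_cont_mult; [apply curve_cont_circ|apply curve_cont_kernel; auto].
    + apply curve_cont_mult; [apply curve_cont_const|].
      apply curve_cont_mult; [apply curve_cont_circ|apply curve_cont_kernel; auto].
    + apply curve_cont_mult; [apply curve_cont_holo_circ; auto|apply curve_cont_circ].
  - intros t. assert (Hn : (circ t - w)%C <> 0) by (apply Cminus_neq0_lt; rewrite Cmod_circ; auto).
    replace (P (circ t)) with (P w + (P (circ t) - P w))%C by ring. rewrite HPq. field; auto.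
Qed.

(** Differentiation under the integral sign. The remainder is required as an exact multiple of
    [(v - w)^2] with a bounded factor, since this is what algebra yields for powers of the Cauchy
    kernel. *)
Lemma Cder_mean (K : C -> R -> C) (K' : R -> C) (r : C -> R -> C) (w : C) (B d : R) : 0 < d ->
  (forall v, Cmod (v - w) < d -> curve_cont (K v)) -> curve_cont K' ->
  (forall v t, Cmod (v - w) < d ->
    (K v t - K w t - (v - w) * K' t = (v - w) * (v - w) * r v t)%C) ->
  (forall v t, Cmod (v - w) < d -> 0 <= t <= 1 -> Cmod (r v t) <= B) ->
  Cder (fun v => mean (K v)) w (mean K').
Proof.
  intros Hd HK HK' Hr HB. apply Cder_eps. intros eps He.
  assert (Hww : Cmod (w - w) < d) by (replace (w - w)%C with (RtoC 0) by ring; rewrite Cmod_0; auto).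
  assert (HB0 : 0 <= B).
  { eapply Rle_trans; [apply Cmod_ge_0|]. apply (HB w 0); auto. lra. }
  exists (Rmin d (eps / (B + 1))). split.
  - apply Rmin_pos; auto. apply Rdiv_lt_0_compat; lra.
  - intros v Hv. assert (H1 := Rlt_le_trans _ _ _ Hv (Rmin_l _ _)).
    assert (H2 := Rlt_le_trans _ _ _ Hv (Rmin_r _ _)).
    rewrite (Cmult_comm (mean K')), <- mean_scal, <- !mean_minus; auto.
    + apply Cmod_mean_le.
      * apply curve_cont_minus; [apply curve_cont_minus|apply curve_cont_mult]; auto. apply curve_cont_const.
      * intros t Ht. rewrite Hr by auto. rewrite !Cmod_mult.
        set (h := Cmod (v - w)) in *. assert (0 <= h) by apply Cmod_ge_0.
        specialize (HB v t H1 Ht).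
        assert (h * (B + 1) <= eps).
        { apply Rmult_lt_compat_r with (r := B + 1) in H2; [|lra].
          replace (eps / (B + 1) * (B + 1)) with eps in H2 by (field; lra). lra. }
        assert (0 <= Cmod (r v t)) by apply Cmod_ge_0.
        assert (h * Cmod (r v t) <= eps) by nra. nra.
    + apply curve_cont_minus; auto.
    + apply curve_cont_mult; auto. apply curve_cont_const.
Qed.

Definition cker (v : C) (t : R) : C := (/ (circ t - v))%C.

Lemma kernel_near (w v : C) (t : R) : Cmod w < 1 -> Cmod (v - w) < (1 - Cmod w) / 2 ->
  Cmod v < 1 /\ Cmod (cker v t) <= 2 / (1 - Cmod w) /\ Cmod (cker w t) <= 2 / (1 - Cmod w) /\
  (cker v t - cker w t = (v - w) * cker w t * cker v t)%C.
Proof.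
  intros Hw Hv. assert (Cmod v <= Cmod w + (1 - Cmod w) / 2).
  { replace v with ((v - w) + w)%C by ring. eapply Rle_trans; [apply Cmod_triangle|]. lra. }
  assert (Hb : forall u, Cmod u <= Cmod w + (1 - Cmod w) / 2 -> (circ t - u)%C <> 0 /\ Cmod (cker u t) <= 2 / (1 - Cmod w)).
  { intros u Hu. assert (Hn : (circ t - u)%C <> 0) by (apply Cminus_neq0_lt; rewrite Cmod_circ; lra).
    split; auto. unfold cker. rewrite Cmod_inv by auto.
    replace (2 / (1 - Cmod w)) with (/ ((1 - Cmod w) / 2)) by (field; lra).
    apply Rinv_le_contravar; [lra|]. generalize (Cmod_triangle_rev (circ t) u). rewrite Cmod_circ. lra. }
  destruct (Hb v) as [Hv0 Hv1]; auto. destruct (Hb w) as [Hw0 Hw1]; [lra|].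
  repeat split; auto; [lra|]. unfold cker. field. auto.
Qed.

Lemma curve_cont_cker (v : C) : Cmod v < 1 -> curve_cont (cker v).
Proof. apply curve_cont_kernel. Qed.

Ltac cker_cont :=
  lazymatch goal with
  | |- curve_cont (fun t => (@?f t * @?g t)%C) => apply (curve_cont_mult f g); cker_cont
  | |- curve_cont (fun t => cker ?v t) => apply (curve_cont_cker v); assumption
  | |- curve_cont (fun t => RtoC ?c) => apply (curve_cont_const (RtoC c))
  | |- _ => assumption
  end.

(* With [x = cker w t], [y = cker v t] and [k = v - w], the remainders below come from iterating
   the resolvent identity [y - x = k x y]. *)
Lemma Cder_kernel1 (phi : R -> C) (w : C) : curve_cont phi -> Cmod w < 1 ->
  Cder (fun v => mean (fun t => phi t * cker v t)%C) w (mean (fun t => phi t * (cker w t * cker w t))%C).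
Proof.
  intros Hphi Hw. set (B := 2 / (1 - Cmod w)).
  assert (HB : 0 < B) by (apply Rdiv_lt_0_compat; lra).
  destruct (curve_bounded phi Hphi) as [M [HM0 HM]].
  apply (Cder_mean (fun v t => phi t * cker v t)%C _ (fun v t => phi t * (cker w t * cker w t * cker v t))%C
    w (M * (B * B * B)) ((1 - Cmod w) / 2)).
  - lra.
  - intros v Hv. destruct (kernel_near w v 0 Hw Hv) as [Hv1 _]. cker_cont.
  - cker_cont.
  - intros v t Hv. destruct (kernel_near w v t Hw Hv) as (_ & _ & _ & E).
    replace (cker v t) with (cker w t + (v - w) * cker w t * cker v t)%C at 1 by (rewrite <- E; ring).
    transitivity (phi t * (v - w) * cker w t * (cker v t - cker w t))%C; [ring|rewrite E; ring].
  - intros v t Hv Ht. destruct (kernel_near w v t Hw Hv) as (_ & H1 & H2 & _). fold B in H1, H2.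
    rewrite !Cmod_mult. specialize (HM t Ht).
    repeat apply Rmult_le_compat; auto; repeat apply Rmult_le_pos; apply Cmod_ge_0.
Qed.

Lemma Cder_kernel2 (phi : R -> C) (w : C) : curve_cont phi -> Cmod w < 1 ->
  Cder (fun v => mean (fun t => phi t * (cker v t * cker v t))%C) w
    (mean (fun t => phi t * (2 * (cker w t * cker w t * cker w t)))%C).
Proof.
  intros Hphi Hw. set (B := 2 / (1 - Cmod w)).
  assert (HB : 0 < B) by (apply Rdiv_lt_0_compat; lra).
  destruct (curve_bounded phi Hphi) as [M [HM0 HM]].
  apply (Cder_mean (fun v t => phi t * (cker v t * cker v t))%C _
    (fun v t => phi t * (cker w t * cker w t * cker v t * (cker v t + 2 * cker w t)))%C
    w (M * (B * B * B * (B + 2 * B))) ((1 - Cmod w) / 2)).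
  - lra.
  - intros v Hv. destruct (kernel_near w v 0 Hw Hv) as [Hv1 _]. cker_cont.
  - cker_cont.
  - intros v t Hv. destruct (kernel_near w v t Hw Hv) as (_ & _ & _ & E).
    set (y := cker v t) in *. set (x := cker w t) in *. set (k := (v - w)%C) in *.
    assert (E' : y = (x + k * x * y)%C) by (rewrite <- E; ring).
    transitivity (phi t * ((y - x) * (y + x) - 2 * k * x * x * x))%C; [ring|].
    rewrite E.
    transitivity (phi t * (k * x * ((y - x) * (y + 2 * x))))%C; [ring|]. rewrite E. ring.
  - intros v t Hv Ht. destruct (kernel_near w v t Hw Hv) as (_ & H1 & H2 & _). fold B in H1, H2.
    rewrite !Cmod_mult. specialize (HM t Ht).
    repeat apply Rmult_le_compat; auto; repeat apply Rmult_le_pos; try apply Cmod_ge_0.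
    eapply Rle_trans; [apply Cmod_triangle|]. rewrite Cmod_mult, Cmod_R, Rabs_pos_eq; lra.
Qed.

Lemma Cder_kernel3 (phi : R -> C) (w : C) : curve_cont phi -> Cmod w < 1 ->
  Cder (fun v => mean (fun t => phi t * (cker v t * cker v t * cker v t))%C) w
    (mean (fun t => phi t * (3 * (cker w t * cker w t * cker w t * cker w t)))%C).
Proof.
  intros Hphi Hw. set (B := 2 / (1 - Cmod w)).
  assert (HB : 0 < B) by (apply Rdiv_lt_0_compat; lra).
  destruct (curve_bounded phi Hphi) as [M [HM0 HM]].
  apply (Cder_mean (fun v t => phi t * (cker v t * cker v t * cker v t))%C _
    (fun v t => phi t * (cker w t * cker w t * cker v t * (cker v t * cker v t + 2 * (cker v t * cker w t) + 3 * (cker w t * cker w t))))%C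
    w (M * (B * B * B * (B * B + 2 * (B * B) + 3 * (B * B)))) ((1 - Cmod w) / 2)).
  - lra.
  - intros v Hv. destruct (kernel_near w v 0 Hw Hv) as [Hv1 _]. cker_cont.
  - cker_cont.
  - intros v t Hv. destruct (kernel_near w v t Hw Hv) as (_ & _ & _ & E).
    set (y := cker v t) in *. set (x := cker w t) in *. set (k := (v - w)%C) in *.
    transitivity (phi t * ((y - x) * (y * y + y * x + x * x) - 3 * k * x * x * x * x))%C; [ring|].
    rewrite E.
    transitivity (phi t * (k * x * ((y - x) * (y * y + 2 * (y * x) + 3 * (x * x)))))%C; [ring|]. rewrite E. ring.
  - intros v t Hv Ht. destruct (kernel_near w v t Hw Hv) as (_ & H1 & H2 & _). fold B in H1, H2.
    specialize (HM t Ht).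
    assert (P1 := Cmod_ge_0 (cker v t)). assert (P2 := Cmod_ge_0 (cker w t)).
    assert (Cmod (cker v t * cker v t + 2 * (cker v t * cker w t) + 3 * (cker w t * cker w t)) <= B * B + 2 * (B * B) + 3 * (B * B)).
    { eapply Rle_trans; [apply Cmod_triangle|]. eapply Rle_trans; [apply Rplus_le_compat_r, Cmod_triangle|].
      rewrite !Cmod_mult, !Cmod_R, !Rabs_pos_eq by lra.
      assert (Cmod (cker v t) * Cmod (cker v t) <= B * B) by (apply Rmult_le_compat; auto).
      assert (Cmod (cker v t) * Cmod (cker w t) <= B * B) by (apply Rmult_le_compat; auto).
      assert (Cmod (cker w t) * Cmod (cker w t) <= B * B) by (apply Rmult_le_compat; auto). lra. }
    rewrite !(Cmod_mult (phi t)), (Cmod_mult (_ * _ * _)), !(Cmod_mult (_ * _) (cker v t)), (Cmod_mult (cker w t)).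
    repeat apply Rmult_le_compat; auto; repeat apply Rmult_le_pos; try apply Cmod_ge_0.
Qed.

(** * Derivatives of entire functions and Harnack's inequality *)

Lemma ball_in_unit_disc (w v : C) : Cmod (v - w) < 1 - Cmod w -> Cmod v < 1.
Proof.
  intros H. replace v with ((v - w) + w)%C by ring.
  eapply Rle_lt_trans; [apply Cmod_triangle|]. lra.
Qed.

(* Cauchy's formula for [P] can be differentiated three times, so [f' = P''] is differentiable. *)
Lemma second_derivative_holo_0 (P f f' : C -> C) : (forall z, Cder P z (f z)) ->
  (forall z, Cder f z (f' z)) -> exists l, Cder f' 0 l.
Proof.
  intros HP Hf.
  assert (Hfh : holo f) by (intros z; exists (f' z); auto).
  set (phi := fun t => (P (circ t) * circ t)%C).
  assert (Hphi : curve_cont phi).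
  { apply curve_cont_mult; [apply curve_cont_holo_circ|apply curve_cont_circ].
    intros z; exists (f z); auto. }
  assert (H0 : forall w, Cmod w < 1 -> mean (fun t => phi t * cker w t)%C = P w).
  { intros w Hw. rewrite (cauchy_primitive P f w HP Hfh Hw). apply mean_ext.
    intros t. unfold phi, cker. ring. }
  assert (H1 : forall w, Cmod w < 1 -> mean (fun t => phi t * (cker w t * cker w t))%C = f w).
  { intros w Hw. apply (Cder_unique P w); auto.
    apply (Cder_ext_loc _ _ w _ (1 - Cmod w)) with (3 := Cder_kernel1 phi w Hphi Hw); [lra|].
    intros v Hv. apply H0, (ball_in_unit_disc w); auto. }
  assert (H2 : forall w, Cmod w < 1 ->
    mean (fun t => phi t * (2 * (cker w t * cker w t * cker w t)))%C = f' w).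
  { intros w Hw. apply (Cder_unique f w); auto.
    apply (Cder_ext_loc _ _ w _ (1 - Cmod w)) with (3 := Cder_kernel2 phi w Hphi Hw); [lra|].
    intros v Hv. apply H1, (ball_in_unit_disc w); auto. }
  assert (Hz : Cmod 0 < 1) by (rewrite Cmod_0; lra).
  (* The factor 2 left by the previous differentiation is moved into the weight, so that
     [Cder_kernel3] applies. *)
  assert (Hphi2 : curve_cont (fun t => phi t * 2)%C).
  { apply curve_cont_mult; auto. apply curve_cont_const. }
  eexists.
  apply (Cder_ext_loc _ _ 0 _ (1 - Cmod 0)) with (3 := Cder_kernel3 _ 0 Hphi2 Hz); [lra|].
  intros v Hv. rewrite <- H2 by (apply (ball_in_unit_disc 0); auto).
  apply mean_ext. intros t. ring.
Qed.

Lemma Cder_affine (a c z : C) : Cder (fun w => c + a * w)%C z a.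
Proof.
  assert (H : Cder (fun w => c + a * w)%C z (0 + a * 1)%C).
  { apply Cder_plus; [apply Cder_const|apply Cder_scal, Cder_id]. }
  replace (0 + a * 1)%C with a in H by ring. exact H.
Qed.

Lemma Cder_comp_affine (f : C -> C) (a c z l : C) : Cder f (c + a * z)%C l ->
  Cder (fun w => f (c + a * w)%C) z (a * l).
Proof. intros H. apply (Cder_comp f (fun w => c + a * w)%C); auto. apply Cder_affine. Qed.

(** A primitive of [f] supplies the order of differentiability that the Cauchy formula above asks
    for, and a translation moves [c] to 0. The factors [1] bring the translation into the affine
    form of [Cder_comp_affine]. *)
Theorem holo_der (f f' : C -> C) : (forall z, Cder f z (f' z)) -> holo f'.
Proof.
  intros Hf c.
  destruct (holo_primitive f) as [P HP]; [intros z; exists (f' z); auto|].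
  destruct (second_derivative_holo_0 (fun z => P (c + 1 * z)) (fun z => 1 * f (c + 1 * z))
    (fun z => 1 * (1 * f' (c + 1 * z))))%C as [l Hl].
  - intros z. apply Cder_comp_affine, HP.
  - intros z. apply Cder_scal. apply Cder_comp_affine, Hf.
  - exists (1 * l)%C. apply (Cder_ext (fun z => 1 * (1 * f' (c + 1 * (- c + 1 * z))))%C).
    + intros w. rewrite !Cmult_1_l. f_equal. ring.
    + apply (Cder_comp_affine (fun z => 1 * (1 * f' (c + 1 * z)))%C 1 (-c) c).
      replace (- c + 1 * c)%C with (RtoC 0) by ring. auto.
Qed.

Lemma cauchy (G : C -> C) (w : C) : holo G -> Cmod w < 1 ->
  G w = mean (fun t => G (circ t) * (circ t * / (circ t - w)))%C.
Proof.
  intros HG Hw. apply choice in HG. destruct HG as [g Hg].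
  apply (cauchy_primitive G g); auto. apply (holo_der G); auto.
Qed.

Lemma mean_value (G : C -> C) : holo G -> mean (fun t => G (circ t)) = G 0.
Proof.
  intros HG. rewrite (cauchy G 0) by (auto; rewrite Cmod_0; lra).
  apply mean_ext. intros t. replace (circ t - 0)%C with (circ t) by ring.
  field. apply circ_neq0.
Qed.

(** Inversion maps the disc of radius [r] around 1 to the disc with diameter from [1 / (1 + r)] to
    [1 / (1 - r)] on the real axis. *)
Lemma Re_inv_ge (s : C) (r : R) : 0 <= r < 1 -> Cmod (1 - s) <= r -> / (1 + r) <= Re (/ s)%C.
Proof.
  intros Hr Hs. destruct s as [x y].
  assert (H : (1 - x) * (1 - x) + y * y <= r * r).
  { assert (E := Cmod2_alt (1 - (x, y))). simpl in E.
    assert (Cmod (1 - (x, y)) ^ 2 <= r ^ 2) by (apply pow_incr; split; auto; apply Cmod_ge_0).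
    simpl in *. nra. }
  simpl. assert (Hx : 0 < x) by nra.
  assert (Hm : 0 < x * x + y * y) by nra.
  replace (x / (x * (x * 1) + y * (y * 1))) with (x / (x * x + y * y)) by (f_equal; ring).
  apply Rmult_le_reg_r with ((1 + r) * (x * x + y * y)); [nra|].
  replace (/ (1 + r) * ((1 + r) * (x * x + y * y))) with (x * x + y * y) by (field; lra).
  replace (x / (x * x + y * y) * ((1 + r) * (x * x + y * y))) with (x * (1 + r)) by (field; lra).
  assert (Hx1 : x <= 1 + r) by nra.
  assert (x * x + y * y <= 2 * x + r * r - 1) by lra.
  nra.
Qed.

(* Adding Cauchy's formula for [G] at [w] to the conjugate of [mean_circ_geom] at [Cconj w] gives
   the Poisson representation of [Re G w]. *)
Theorem harnack_unit (G : C -> C) (w : C) : holo G -> (forall t, 0 <= Re (G (circ t))) -> Cmod w < 1 ->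
  (1 - Cmod w) / (1 + Cmod w) * Re (G 0) <= Re (G w).
Proof.
  intros HG Hpos Hw. set (r := Cmod w) in *. assert (Hr : 0 <= r) by apply Cmod_ge_0.
  assert (HGc := curve_cont_holo_circ G HG).
  set (k := fun t => (circ t * / (circ t - w))%C).
  assert (Hkc : curve_cont k).
  { apply curve_cont_mult; [apply curve_cont_circ|apply curve_cont_kernel; auto]. }
  assert (H1 : mean (fun t => G (circ t) * k t)%C = G w) by (symmetry; apply cauchy; auto).
  assert (Hw' : Cmod (Cconj w) < 1) by (rewrite Cmod_conj; auto).
  assert (HGic : curve_cont (fun t => G (circ t) * / (1 - Cconj w * circ t))%C).
  { apply curve_cont_mult; auto. apply curve_cont_inv.
    - apply curve_cont_minus; [apply curve_cont_const|].
      apply curve_cont_mult; [apply curve_cont_const|apply curve_cont_circ].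
    - intros t. apply Cminus_neq0_lt. rewrite Cmod_mult, Cmod_circ, Cmod_1. lra. }
  assert (H2 : mean (fun t => Cconj (G (circ t)) * k t)%C = Cconj (G 0)).
  { rewrite <- (mean_circ_geom G (Cconj w) HG (mean_value G HG) Hw').
    rewrite <- mean_conj by auto. apply mean_ext. intros t. unfold k.
    rewrite (circ_kernel w t Hw), Cmult_conj. auto. }
  assert (H3 := mean_value G HG).
  (* The Poisson kernel is [2 * Re (k t) - 1]. As [c] is a lower bound of [2 * Re (k t)], the
     constant [c - 1] is the one in Harnack's inequality. *)
  set (c := (2 / (1 + r))).
  assert (Hc : curve_cont (fun t => Cconj (G (circ t)) * k t)%C).
  { apply curve_cont_mult; auto. apply curve_cont_conj; auto. }
  assert (Hc1 : curve_cont (fun t => G (circ t) * k t)%C) by (apply curve_cont_mult; auto).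
  assert (E : (G w + Cconj (G 0) - RtoC c * G 0)%C =
    mean (fun t => G (circ t) * k t + Cconj (G (circ t)) * k t - RtoC c * G (circ t))%C).
  { rewrite mean_minus, mean_plus, mean_scal, H1, H2, H3; auto.
    - apply curve_cont_plus; auto.
    - apply curve_cont_mult; auto. apply curve_cont_const. }
  assert (Hge : 0 <= Re (G w + Cconj (G 0) - RtoC c * G 0)%C).
  { rewrite E. apply Re_mean_ge.
    - apply curve_cont_minus; [apply curve_cont_plus; auto|].
      apply curve_cont_mult; auto. apply curve_cont_const.
    - intros t. specialize (Hpos t).
      assert (Hk : c / 2 <= Re (k t)).
      { replace (k t) with (/ (1 - w * Cconj (circ t)))%C.
        - replace (c / 2) with (/ (1 + r)) by (unfold c; field; lra). apply Re_inv_ge; auto.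
          replace (1 - (1 - w * Cconj (circ t)))%C with (w * Cconj (circ t))%C by ring.
          rewrite Cmod_mult, Cmod_conj, Cmod_circ. fold r. lra.
        - assert (Hn : (circ t - w)%C <> 0) by (apply Cminus_neq0_lt; rewrite Cmod_circ; auto).
          assert (Hcc : Cconj (circ t) <> 0) by (apply Cmod_gt_0; rewrite Cmod_conj, Cmod_circ; lra).
          assert (H1c := circ_conj t).
          replace (1 - w * Cconj (circ t))%C with ((circ t - w) * Cconj (circ t))%C by (rewrite <- H1c; ring).
          unfold k. apply (Cmult_eq_reg_l ((circ t - w) * Cconj (circ t))).
          + apply Cmult_neq_0; auto.
          + rewrite Cinv_r by (apply Cmult_neq_0; auto). rewrite <- H1c. field; auto. }
      assert (X : Re (G (circ t) * k t + Cconj (G (circ t)) * k t - RtoC c * G (circ t))%C =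
        Re (G (circ t)) * (2 * Re (k t) - c)).
      { destruct (G (circ t)), (k t); simpl. ring. }
      rewrite X. apply Rmult_le_pos; lra. }
  replace (Re (G w + Cconj (G 0) - RtoC c * G 0)%C) with (Re (G w) + Re (G 0) - c * Re (G 0)) in Hge.
  2:{ destruct (G w), (G 0); simpl. ring. }
  replace ((1 - r) / (1 + r)) with (c - 1) by (unfold c; field; lra). lra.
Qed.

Theorem harnack (G : C -> C) (c z : C) (s : R) : 0 < s -> holo G ->
  (forall w, Cmod (w - c) = s -> 0 <= Re (G w)) -> Cmod (z - c) < s ->
  (s - Cmod (z - c)) / (s + Cmod (z - c)) * Re (G c) <= Re (G z).
Proof.
  intros Hs HG Hpos Hz.
  assert (Hs0 : RtoC s <> 0) by (intro E; injection E; lra).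
  assert (H := harnack_unit (fun w => G (c + RtoC s * w)%C) ((z - c) / RtoC s)%C).
  assert (Hm : Cmod ((z - c) / RtoC s) = Cmod (z - c) / s).
  { rewrite Cmod_div, Cmod_R, Rabs_pos_eq by (auto; lra). auto. }
  rewrite Hm in H.
  replace (c + RtoC s * ((z - c) / RtoC s))%C with z in H by (field; auto).
  replace (c + RtoC s * 0)%C with c in H by ring.
  assert (0 <= Cmod (z - c)) by apply Cmod_ge_0.
  replace ((s - Cmod (z - c)) / (s + Cmod (z - c))) with ((1 - Cmod (z - c) / s) / (1 + Cmod (z - c) / s)).
  2:{ field. lra. }
  apply H.
  - apply (holo_comp G (fun w => c + RtoC s * w)%C); auto. intros w. eexists. apply Cder_affine.
  - intros t. apply Hpos. replace (c + RtoC s * circ t - c)%C with (RtoC s * circ t)%C by ring.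
    rewrite Cmod_mult, Cmod_circ, Cmod_R, Rabs_pos_eq; lra.
  - apply Rlt_div_l; lra.
Qed.

(** * Gradient estimates, Hopf's boundary lemma, Liouville's theorem and compactness of discs *)

Lemma Re_Cder_upper (G : C -> C) (c a : C) : Cder G c a -> forall eps, 0 < eps ->
  exists d, 0 < d /\ forall h, Cmod h < d -> Re (G (c + h)%C) <= Re (G c) + Re (a * h)%C + eps * Cmod h.
Proof.
  intros H eps He. destruct (proj1 (Cder_eps _ _ _) H eps He) as [d [Hd Hw]].
  exists d; split; auto. intros h Hh. specialize (Hw (c + h)%C).
  replace (c + h - c)%C with h in Hw by ring. specialize (Hw Hh).
  assert (X := re_le_Cmod (G (c + h) - G c - a * h)%C).
  assert (Y := Rle_abs (Re (G (c + h) - G c - a * h)%C)).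
  replace (Re (G (c + h) - G c - a * h)%C) with (Re (G (c + h)%C) - Re (G c) - Re (a * h)%C) in * by
    (destruct (G (c + h)%C), (G c), (a * h)%C; simpl; ring).
  lra.
Qed.

(** A step of length [t] in the direction of steepest descent, that of [- Cconj a], lowers [Re G] by
    [t * Cmod a] to first order, whereas Harnack's inequality allows a loss of at most
    [2 * t / (s + t) * Re (G c)]. *)
Lemma gradient_estimate (G : C -> C) (c a : C) (s : R) : 0 < s -> holo G -> Cder G c a ->
  (forall w, Cmod (w - c) <= s -> 0 <= Re (G w)) -> Cmod a <= 2 * Re (G c) / s.
Proof.
  intros Hs HG Ha Hpos.
  assert (Hc : 0 <= Re (G c)).
  { apply Hpos. replace (c - c)%C with (RtoC 0) by ring. rewrite Cmod_0. lra. }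
  destruct (Req_dec (Cmod a) 0) as [->|Hn].
  { apply Rmult_le_pos; [lra|left; apply Rinv_0_lt_compat; auto]. }
  assert (Ha0 : 0 < Cmod a) by (generalize (Cmod_ge_0 a); lra).
  apply le_epsilon. intros eps He.
  destruct (Re_Cder_upper G c a Ha eps He) as [d [Hd H]].
  set (t := Rmin d s / 2). assert (Ht : 0 < t) by (unfold t; generalize (Rmin_pos _ _ Hd Hs); lra).
  assert (Htd : t < d) by (unfold t in *; generalize (Rmin_l d s); lra).
  assert (Hts : t < s) by (unfold t in *; generalize (Rmin_r d s); lra).
  set (h := (RtoC (- (t / Cmod a)) * Cconj a)%C).
  assert (Hh : Cmod h = t).
  { unfold h. rewrite Cmod_mult, Cmod_R, Rabs_Ropp, Cmod_conj, Rabs_pos_eq.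
    - field; lra.
    - left. apply Rdiv_lt_0_compat; auto. }
  assert (Hah : Re (a * h)%C = - (t * Cmod a)).
  { unfold h. replace (a * (RtoC (- (t / Cmod a)) * Cconj a))%C with (RtoC (- (t / Cmod a)) * (a * Cconj a))%C by ring.
    rewrite <- Cmod2_conj, <- RtoC_mult. simpl. field; lra. }
  specialize (H h ltac:(lra)). rewrite Hah, Hh in H.
  assert (K := harnack G c (c + h)%C s Hs HG).
  replace (c + h - c)%C with h in K by ring. rewrite Hh in K.
  assert (K' : (s - t) / (s + t) * Re (G c) <= Re (G (c + h)%C)).
  { apply K; auto. intros w Hw. apply Hpos. lra. }
  replace ((s - t) / (s + t)) with (1 - 2 * t / (s + t)) in K' by (field; lra).
  assert (Hq : 2 * t / (s + t) * Re (G c) <= t * (2 * Re (G c) / s)).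
  { replace (2 * t / (s + t) * Re (G c)) with (t * (2 * Re (G c) / (s + t))) by (field; lra).
    apply Rmult_le_compat_l; [lra|]. apply Rmult_le_compat_l; [lra|]. apply Rinv_le_contravar; lra. }
  apply Rmult_le_reg_l with t; auto. lra.
Qed.

(** Both [M + G] and [M - G] have nonnegative real part. Averaging their two estimates cancels
    [Re (G c)], so the constant stays 2. *)
Lemma gradient_bound (G : C -> C) (c a : C) (s M : R) : 0 < s -> holo G -> Cder G c a ->
  (forall w, Cmod (w - c) <= s -> Rabs (Re (G w)) <= M) -> Cmod a <= 2 * M / s.
Proof.
  intros Hs HG Ha HM.
  assert (H1 : Cmod (0 + a) <= 2 * Re (RtoC M + G c)%C / s).
  { apply (gradient_estimate (fun w => RtoC M + G w)%C c); auto.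
    - apply holo_plus; auto. apply holo_const.
    - apply Cder_plus; auto. apply Cder_const.
    - intros w Hw. specialize (HM w Hw). apply Rabs_le_between in HM. change (0 <= M + Re (G w)). lra. }
  assert (H2 : Cmod (0 - a) <= 2 * Re (RtoC M - G c)%C / s).
  { apply (gradient_estimate (fun w => RtoC M - G w)%C c); auto.
    - apply holo_minus; auto. apply holo_const.
    - apply Cder_minus; auto. apply Cder_const.
    - intros w Hw. specialize (HM w Hw). apply Rabs_le_between in HM. change (0 <= M + - Re (G w)). lra. }
  rewrite Cplus_0_l in H1. replace (0 - a)%C with (- a)%C in H2 by ring. rewrite Cmod_opp in H2.
  change (Cmod a <= 2 * (M + Re (G c)) / s) in H1. change (Cmod a <= 2 * (M + - Re (G c)) / s) in H2.
  replace (2 * M / s) with ((2 * (M + Re (G c)) / s + 2 * (M + - Re (G c)) / s) / 2) by (field; lra). lra.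
Qed.

(** On the radius towards [p], at distance [t * s] from [p], Harnack's inequality forces [Re G] to
    be at least [t / 2 * Re (G c)], while to first order it is at most [Cmod a * (t * s)]. *)
Lemma hopf (G : C -> C) (c p a : C) (s : R) : 0 < s -> holo G -> Cder G p a ->
  Cmod (p - c) = s -> Re (G p) = 0 -> (forall w, Cmod (w - c) <= s -> 0 <= Re (G w)) ->
  Re (G c) <= 2 * s * Cmod a.
Proof.
  intros Hs HG Ha Hp Hp0 Hpos.
  assert (Hc : 0 <= Re (G c)).
  { apply Hpos. replace (c - c)%C with (RtoC 0) by ring. rewrite Cmod_0. lra. }
  apply le_epsilon. intros eps He.
  destruct (Re_Cder_upper G p a Ha (eps / (2 * s))) as [d [Hd H]].
  { apply Rdiv_lt_0_compat; lra. }
  set (t := Rmin (d / s) 1 / 2).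
  assert (Hds : 0 < d / s) by (apply Rdiv_lt_0_compat; auto).
  assert (Ht : 0 < t) by (unfold t; generalize (Rmin_pos (d / s) 1 Hds Rlt_0_1); lra).
  assert (Htd : t < d / s) by (unfold t in *; generalize (Rmin_l (d / s) 1); lra).
  assert (Hts : t < 1) by (unfold t in *; generalize (Rmin_r (d / s) 1); lra).
  apply Rlt_div_r in Htd; auto.
  set (h := (RtoC t * (c - p))%C).
  assert (Hh : Cmod h = t * s).
  { unfold h. rewrite Cmod_mult, Cmod_R, Rabs_pos_eq, Cmod_minus_sym, Hp; lra. }
  specialize (H h ltac:(lra)). rewrite Hh, Hp0 in H.
  assert (Hah : Re (a * h)%C <= Cmod a * (t * s)).
  { rewrite <- Hh, <- Cmod_mult. eapply Rle_trans; [apply Rle_abs|apply re_le_Cmod]. }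
  assert (K := harnack G c (p + h)%C s Hs HG).
  assert (Hm : Cmod (p + h - c) = (1 - t) * s).
  { replace (p + h - c)%C with (RtoC (1 - t) * (p - c))%C by (unfold h; rewrite RtoC_minus; ring).
    rewrite Cmod_mult, Cmod_R, Rabs_pos_eq, Hp; lra. }
  rewrite Hm in K.
  assert (K' : (s - (1 - t) * s) / (s + (1 - t) * s) * Re (G c) <= Re (G (p + h)%C)).
  { apply K; [intros w Hw; apply Hpos; lra|nra]. }
  replace ((s - (1 - t) * s) / (s + (1 - t) * s)) with (t / (2 - t)) in K' by (field; nra).
  assert (Hq : t * (Re (G c) / 2) <= t / (2 - t) * Re (G c)).
  { replace (t / (2 - t) * Re (G c)) with (t * (Re (G c) / (2 - t))) by (field; lra).
    apply Rmult_le_compat_l; [lra|]. apply Rmult_le_compat_l; [lra|]. apply Rinv_le_contravar; lra. }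
  replace (eps / (2 * s) * (t * s)) with (t * (eps / 2)) in H by (field; lra).
  assert (t * (Re (G c) / 2) <= t * (Cmod a * s + eps / 2)) by lra.
  apply Rmult_le_reg_l in H0; auto. lra.
Qed.

Lemma Cmod_increment_le (f f' : C -> C) (a b : C) (M : R) : (forall z, Cder f z (f' z)) ->
  (forall t, 0 <= t <= 1 -> Cmod (f' (lin a b t)) <= M) -> Cmod (f b - f a) <= M * Cmod (b - a).
Proof.
  intros Hf HM. assert (Hc : forall z, Ccont f' z) by (apply holo_cont, (holo_der f); auto).
  rewrite <- (seg_der f f') by auto. apply Cmod_seg_le; auto.
Qed.

Lemma Cder_zero_const (f : C -> C) (a b : C) : (forall z, Cder f z 0) -> f a = f b.
Proof.
  intros H. assert (X := Cmod_increment_le f (fun _ => 0) a b 0 H).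
  assert (E : (f b - f a)%C = 0).
  { apply Cmod_eq_0, Rle_antisym; [|apply Cmod_ge_0]. eapply Rle_trans; [apply X|lra].
    intros; rewrite Cmod_0; lra. }
  replace (f b) with (f b - f a + f a)%C by ring. rewrite E. ring.
Qed.

(** Liouville's theorem for [f']: the gradient bound on arbitrarily large discs makes the second
    derivative vanish. *)
Lemma bounded_derivative_affine (f f' : C -> C) (M : R) : (forall z, Cder f z (f' z)) ->
  (forall z, Cmod (f' z) <= M) -> forall z, f z = (f 0 + f' 0 * z)%C.
Proof.
  intros Hf HM. assert (Hh := holo_der f f' Hf).
  assert (HM0 : 0 <= M) by (eapply Rle_trans; [apply Cmod_ge_0|apply (HM 0)]).
  assert (H0 : forall z, Cder f' z 0).
  { intros z. destruct (Hh z) as [l Hl].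
    assert (E : l = 0); [|rewrite <- E; auto].
    apply Cmod_eq_0, Rle_antisym; [|apply Cmod_ge_0]. apply le_epsilon. intros eps He.
    assert (X := gradient_bound f' z l (2 * (M + 1) / eps) M).
    eapply Rle_trans; [apply X; auto|].
    - apply Rdiv_lt_0_compat; lra.
    - intros w _. eapply Rle_trans; [apply re_le_Cmod|apply HM].
    - rewrite Rplus_0_l. replace (2 * M / (2 * (M + 1) / eps)) with (eps * (M / (M + 1))) by (field; lra).
      rewrite <- (Rmult_1_r eps) at 2. apply Rmult_le_compat_l; [lra|]. apply Rle_div_l; lra. }
  intros z.
  assert (E : (f z - f' 0 * z = f 0 - f' 0 * 0)%C).
  { apply (Cder_zero_const (fun w => f w - f' 0 * w)%C). intros w.
    assert (D : Cder (fun w => f w - f' 0 * w)%C w (f' w - f' 0 * 1)%C).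
    { apply Cder_minus; auto. apply Cder_scal, Cder_id. }
    rewrite (Cder_zero_const f' w 0 H0) in D.
    replace (f' 0 - f' 0 * 1)%C with (RtoC 0) in D by ring. exact D. }
  replace (f z) with ((f z - f' 0 * z) + f' 0 * z)%C by ring. rewrite E. ring.
Qed.

(** Compactness in the form needed for [nearest_zero]: an open condition on a closed disc persists
    on a slightly larger disc. *)
Lemma disc_compact (c : C) (s : R) (Q : C -> Prop) : 0 <= s ->
  (forall z, Cmod (z - c) <= s -> exists d, 0 < d /\ forall w, Cmod (w - z) < d -> Q w) ->
  exists d, 0 < d /\ forall w, Cmod (w - c) <= s + d -> Q w.
Proof.
  intros Hs0 HQ.
  (* The covering lemma works on a square, so centres outside the disc need a radius too; theirs is
     so small that they cannot cover a point near the disc. The factor 4 leaves room for [2 * d],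
     which bounds the modulus when both coordinates differ by less than [d], and for the enlargement
     of the disc. *)
  assert (Hg : forall z : C, exists d : posreal,
    (Cmod (z - c) <= s /\ forall w, Cmod (w - z) < 4 * d -> Q w) \/ s + 4 * d < Cmod (z - c)).
  { intros z. destruct (Rle_lt_dec (Cmod (z - c)) s) as [Hz|Hz].
    - destruct (HQ z Hz) as [d [Hd H]]. assert (Hd4 : 0 < d / 4) by lra.
      exists (mkposreal _ Hd4). left. split; auto. intros w Hw. apply H. simpl in Hw. lra.
    - assert (Hd : 0 < (Cmod (z - c) - s) / 8) by lra.
      exists (mkposreal _ Hd). right. simpl. lra. }
  apply choice in Hg. destruct Hg as [dl Hdl].
  destruct c as [x y].
  destruct (compactness_value_2d (x - (s + 1)) (x + (s + 1)) (y - (s + 1)) (y + (s + 1))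
    (fun u v => dl (u, v))) as [d Hd].
  exists (Rmin d 1). split; [apply Rmin_pos; [apply cond_pos|lra]|].
  intros [a b] Hw. apply NNPP. intros HnQ.
  assert (H1 := Rmin_l d 1). assert (H2 := Rmin_r d 1).
  assert (Ha := re_le_Cmod ((a, b) - (x, y))). change (Rabs (a - x) <= Cmod ((a, b) - (x, y))) in Ha.
  assert (Hb := im_le_Cmod ((a, b) - (x, y))). change (Rabs (b - y) <= Cmod ((a, b) - (x, y))) in Hb.
  apply Rabs_le_between in Ha. apply Rabs_le_between in Hb.
  apply (Hd a b); [lra|lra|].
  intros (u & v & _ & _ & Hu & Hv & Hduv).
  assert (Hz : Cmod ((a, b) - (u, v)) < 2 * dl (u, v)).
  { eapply Rle_lt_trans; [apply Cmod_le_Re_Im|].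
    change (Rabs (a - u) + Rabs (b - v) < 2 * dl (u, v)). lra. }
  assert (P := cond_pos (dl (u, v))).
  destruct (Hdl (u, v)) as [[_ H]|H].
  - apply HnQ, H. lra.
  - assert (T := Cmod_triangle ((u, v) - (a, b)) ((a, b) - (x, y))).
    replace ((u, v) - (a, b) + ((a, b) - (x, y)))%C with ((u, v) - (x, y))%C in T by ring.
    rewrite (Cmod_minus_sym (u, v) (a, b)) in T. lra.
Qed.

(** Enlarge the disc around [c] as long as [Re G] stays positive; [p0] bounds its radius. Without a
    zero on the limiting circle, compactness would permit a further enlargement. The result is the
    touching configuration that [hopf] requires. *)
Lemma nearest_zero (G : C -> C) (c p0 : C) : holo G -> 0 < Re (G c) -> Re (G p0) <= 0 ->
  exists p, 0 < Cmod (p - c) <= Cmod (p0 - c) /\ Re (G p) = 0 /\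
    forall w, Cmod (w - c) <= Cmod (p - c) -> 0 <= Re (G w).
Proof.
  intros HG Hc Hp0.
  assert (Hloc : forall z, 0 < Re (G z) -> exists d, 0 < d /\ forall w, Cmod (w - z) < d -> 0 < Re (G w)).
  { intros z Hz. destruct (proj1 (Ccont_eps _ _) (holo_cont G HG z) (Re (G z)) Hz) as [d [Hd H]].
    exists d; split; auto. intros w Hw. specialize (H w Hw).
    assert (X := re_le_Cmod (G w - G z)). assert (Y := Rle_abs (- (Re (G w) - Re (G z)))).
    rewrite Rabs_Ropp in Y. change (Rabs (Re (G w) - Re (G z)) <= Cmod (G w - G z)) in X. lra. }
  set (S := fun r => 0 <= r /\ forall w, Cmod (w - c) <= r -> 0 < Re (G w)).
  assert (Hub : forall r, S r -> r <= Cmod (p0 - c)).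
  { intros r [_ Hr]. destruct (Rle_lt_dec r (Cmod (p0 - c))) as [|Hlt]; auto.
    specialize (Hr p0 ltac:(lra)). lra. }
  destruct (completeness S) as [s [Hs1 Hs2]].
  { exists (Cmod (p0 - c)). intros r Hr. auto. }
  { exists 0. split; [lra|]. intros w Hw.
    assert (E : (w - c)%C = 0) by (apply Cmod_eq_0, Rle_antisym; auto; apply Cmod_ge_0).
    replace w with (w - c + c)%C by ring. rewrite E, Cplus_0_l. auto. }
  assert (Hs0 : 0 < s).
  { destruct (Hloc c Hc) as [d [Hd H]]. apply Rlt_le_trans with (d / 2); [lra|].
    apply Hs1. split; [lra|]. intros w Hw. apply H. lra. }
  assert (Hopen : forall w, Cmod (w - c) < s -> 0 < Re (G w)).
  { intros w Hw. apply NNPP. intros Hn.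
    assert (s <= Cmod (w - c)); [|lra]. apply Hs2. intros r [Hr0 Hr].
    destruct (Rle_lt_dec r (Cmod (w - c))) as [|Hlt]; auto. exfalso. apply Hn, Hr. lra. }
  assert (Hclosed : forall w, Cmod (w - c) <= s -> 0 <= Re (G w)).
  { intros w Hw. apply Rnot_lt_le. intros Hneg.
    destruct (proj1 (Ccont_eps _ _) (holo_cont G HG w) (- Re (G w))) as [d [Hd H]]; [lra|].
    set (t := Rmin 1 (d / (2 * s))).
    assert (Hds : 0 < d / (2 * s)) by (apply Rdiv_lt_0_compat; lra).
    assert (Ht : 0 < t) by (apply Rmin_pos; lra).
    assert (Ht1 : t <= 1) by apply Rmin_l.
    assert (Htd : t * s < d).
    { apply Rle_lt_trans with (d / (2 * s) * s).
      - apply Rmult_le_compat_r; [lra|apply Rmin_r].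
      - replace (d / (2 * s) * s) with (d / 2) by (field; lra). lra. }
    assert (Hm := Cmod_ge_0 (w - c)).
    set (v := (w + RtoC t * (c - w))%C).
    assert (Hv1 : Cmod (v - w) < d).
    { unfold v. replace (w + RtoC t * (c - w) - w)%C with (RtoC t * (c - w))%C by ring.
      rewrite Cmod_mult, Cmod_R, Rabs_pos_eq, Cmod_minus_sym by lra. nra. }
    assert (Hv2 : Cmod (v - c) < s).
    { unfold v. replace (w + RtoC t * (c - w) - c)%C with (RtoC (1 - t) * (w - c))%C by (rewrite RtoC_minus; ring).
      rewrite Cmod_mult, Cmod_R, Rabs_pos_eq by lra. nra. }
    specialize (H v Hv1). specialize (Hopen v Hv2).
    assert (X := re_le_Cmod (G v - G w)). assert (Y := Rle_abs (Re (G v - G w)%C)).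
    change (Re (G v - G w)%C) with (Re (G v) - Re (G w)) in X, Y. lra. }
  destruct (classic (exists p, Cmod (p - c) = s /\ Re (G p) = 0)) as [[p [Hp1 Hp2]]|Hno].
  - exists p. rewrite Hp1. split; [split; [auto|apply Hs2; exact Hub]|auto].
  - exfalso. destruct (disc_compact c s (fun w => 0 < Re (G w))) as [d [Hd H]]; [lra| |].
    + intros z Hz. apply Hloc. destruct (Hclosed z Hz) as [|E]; auto.
      destruct Hz as [Hlt|Heq]; auto.
      exfalso. apply Hno. exists z; auto.
    + assert (s + d <= s); [|lra]. apply Hs1. split; [lra|auto].
Qed.

(** Cauchy's formula reduces the disc to a single curve: on a circle of at least twice the radius
    [G] is bounded as a continuous function of one real parameter, and the kernel is at most 2. *)
Lemma holo_bounded_disc (G : C -> C) (R0 : R) : holo G -> exists M, forall w, Cmod w <= R0 -> Cmod (G w) <= M.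
Proof.
  intros HG. set (s := 2 * (Rabs R0 + 1)).
  assert (HR0 := Rle_abs R0). assert (HR1 := Rabs_pos R0).
  assert (Hs : 0 < s) by (unfold s; lra).
  assert (Hs0 : RtoC s <> 0) by (intro E; injection E; lra).
  set (F := fun w => G (RtoC s * w)%C).
  assert (HF : holo F).
  { apply (holo_comp G (fun w => RtoC s * w)%C); auto. apply holo_mult; [apply holo_const|apply holo_id]. }
  assert (HFc := curve_cont_holo_circ F HF).
  destruct (curve_bounded _ HFc) as [M [HM0 HM]].
  exists (2 * M). intros w Hw.
  assert (Hv : Cmod (w / RtoC s) <= / 2).
  { rewrite Cmod_div, Cmod_R, Rabs_pos_eq by (auto; lra). apply Rle_div_l; auto. unfold s. lra. }
  replace (G w) with (F (w / RtoC s)%C) by (unfold F; f_equal; field; auto).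
  set (v := (w / RtoC s)%C) in *.
  rewrite (cauchy F v) by (auto; lra). apply Cmod_mean_le.
  - apply curve_cont_mult; auto. apply curve_cont_mult; [apply curve_cont_circ|apply curve_cont_kernel; lra].
  - intros t Ht. rewrite !Cmod_mult, Cmod_circ, Cmod_inv.
    2:{ apply Cminus_neq0_lt. rewrite Cmod_circ. lra. }
    assert (/ Cmod (circ t - v) <= / (/ 2)).
    { apply Rinv_le_contravar; [lra|]. generalize (Cmod_triangle_rev (circ t) v). rewrite Cmod_circ. lra. }
    rewrite Rinv_inv in H. specialize (HM t Ht).
    assert (0 <= / Cmod (circ t - v)).
    { left. apply Rinv_0_lt_compat. generalize (Cmod_triangle_rev (circ t) v). rewrite Cmod_circ. lra. }
    generalize (Cmod_ge_0 (F (circ t))). nra.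
Qed.

(** * Exponential rescaling of zero-free functions *)

Definition Cexp (z : C) : C := (exp (Re z) * cos (Im z), exp (Re z) * sin (Im z)).

Lemma Cexp_plus (x y : C) : Cexp (x + y) = (Cexp x * Cexp y)%C.
Proof.
  destruct x, y. unfold Cexp, Cmult; simpl. rewrite exp_plus, cos_plus, sin_plus. f_equal; ring.
Qed.
Lemma Cexp_0 : Cexp 0 = 1.
Proof. unfold Cexp; simpl. rewrite exp_0, cos_0, sin_0. unfold RtoC. f_equal; ring. Qed.
Lemma Cmod_Cexp (z : C) : Cmod (Cexp z) = exp (Re z).
Proof.
  unfold Cmod, Cexp; simpl.
  replace (_ + _) with (exp (Re z) * exp (Re z) * (Rsqr (sin (Im z)) + Rsqr (cos (Im z)))) by (unfold Rsqr; ring).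
  rewrite sin2_cos2, Rmult_1_r. apply sqrt_square. left; apply exp_pos.
Qed.
Lemma Cexp_neq0 (z : C) : Cexp z <> 0.
Proof. apply Cmod_gt_0. rewrite Cmod_Cexp. apply exp_pos. Qed.

(** The addition formula reduces the claim to increments from 0, where the real derivatives of
    [exp], [cos] and [sin] are combined. *)
Lemma Cder_Cexp (z : C) : Cder Cexp z (Cexp z).
Proof.
  apply Cder_eps. intros eps0 He0.
  set (m := Cmod (Cexp z)). assert (Hm : 0 < m) by (apply Cmod_gt_0, Cexp_neq0).
  set (eps := Rmin 1 (eps0 / (8 * m))).
  assert (He : 0 < eps) by (apply Rmin_pos; [lra|apply Rdiv_lt_0_compat; lra]).
  assert (He1 : eps <= 1) by apply Rmin_l.
  assert (Hem : m * (8 * eps) <= eps0).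
  { replace eps0 with (m * (8 * (eps0 / (8 * m)))) by (field; lra).
    apply Rmult_le_compat_l; [lra|]. apply Rmult_le_compat_l; [lra|]. apply Rmin_r. }
  destruct (proj1 (is_derive_eps exp 0 (exp 0)) (is_derive_exp 0) eps He) as [d1 [Hd1 H1]].
  destruct (proj1 (is_derive_eps cos 0 (- sin 0)) (is_derive_cos 0) eps He) as [d2 [Hd2 H2]].
  destruct (proj1 (is_derive_eps sin 0 (cos 0)) (is_derive_sin 0) eps He) as [d3 [Hd3 H3]].
  rewrite exp_0 in H1. rewrite sin_0, cos_0 in H2. rewrite sin_0, cos_0 in H3.
  set (d := Rmin (Rmin d1 (eps / 2)) (Rmin d2 d3)).
  exists d. split; [repeat apply Rmin_pos; auto; lra|].
  intros w Hw. set (h := (w - z)%C) in *.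
  replace w with (z + h)%C by (unfold h; ring). rewrite Cexp_plus.
  replace (Cexp z * Cexp h - Cexp z - Cexp z * h)%C with (Cexp z * (Cexp h - 1 - h))%C by ring.
  rewrite Cmod_mult. fold m.
  assert (Hx := re_le_Cmod h). assert (Hy := im_le_Cmod h).
  destruct h as [x y]. simpl Re in Hx. simpl Im in Hy. set (r := Cmod (x, y)) in *.
  assert (Dl : d <= d1 /\ d <= eps / 2 /\ d <= d2 /\ d <= d3).
  { unfold d. generalize (Rmin_l (Rmin d1 (eps / 2)) (Rmin d2 d3)) (Rmin_r (Rmin d1 (eps / 2)) (Rmin d2 d3))
      (Rmin_l d1 (eps / 2)) (Rmin_r d1 (eps / 2)) (Rmin_l d2 d3) (Rmin_r d2 d3). lra. }
  specialize (H1 x). specialize (H2 y). specialize (H3 y). rewrite Rminus_0_r in *.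
  specialize (H1 ltac:(lra)). specialize (H2 ltac:(lra)). specialize (H3 ltac:(lra)).
  assert (Hex : Rabs (exp x - 1) <= 2 * Rabs x).
  { replace (exp x - 1) with ((exp x - 1 - 1 * x) + x) by ring.
    eapply Rle_trans; [apply Rabs_triang|]. generalize (Rabs_pos x). nra. }
  assert (He3 : exp x <= 2).
  { generalize (Rle_abs (exp x - 1)). lra. }
  assert (Hep := exp_pos x).
  assert (Hb : Cmod (Cexp (x, y) - 1 - (x, y)) <= 8 * eps * r).
  { eapply Rle_trans; [apply Cmod_le_Re_Im|].
    replace (Re (Cexp (x, y) - 1 - (x, y))%C) with ((exp x - 1 - 1 * x) + exp x * (cos y - 1 - - 0 * y)) by
      (unfold Cexp; simpl; ring).
    replace (Im (Cexp (x, y) - 1 - (x, y))%C) with ((exp x - 1) * y + exp x * (sin y - 0 - 1 * y)) by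
      (unfold Cexp; simpl; ring).
    assert (A1 := Rabs_triang (exp x - 1 - 1 * x) (exp x * (cos y - 1 - - 0 * y))).
    assert (A2 := Rabs_triang ((exp x - 1) * y) (exp x * (sin y - 0 - 1 * y))).
    rewrite Rabs_mult, (Rabs_pos_eq (exp x)) in A1 by lra.
    rewrite !Rabs_mult, (Rabs_pos_eq (exp x)) in A2 by lra.
    assert (B1 : exp x * Rabs (cos y - 1 - - 0 * y) <= 2 * (eps * r)).
    { apply Rmult_le_compat; try lra. apply Rabs_pos. eapply Rle_trans; [apply H2|].
      apply Rmult_le_compat_l; lra. }
    assert (B2 : exp x * Rabs (sin y - 0 - 1 * y) <= 2 * (eps * r)).
    { apply Rmult_le_compat; try lra. apply Rabs_pos. eapply Rle_trans; [apply H3|].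
      apply Rmult_le_compat_l; lra. }
    assert (B3 : Rabs (exp x - 1) * Rabs y <= eps * r).
    { apply Rmult_le_compat; try apply Rabs_pos; lra. }
    assert (B4 : eps * Rabs x <= eps * r) by (apply Rmult_le_compat_l; lra).
    assert (0 <= eps * r) by (apply Rmult_le_pos; [lra|apply Cmod_ge_0]).
    lra. }
  eapply Rle_trans; [apply Rmult_le_compat_l; [lra|apply Hb]|].
  rewrite <- Rmult_assoc. apply Rmult_le_compat_r; [apply Cmod_ge_0|auto].
Qed.

(** The control of both parts of the logarithm serves [exp_rescaling], where the logarithm is a
    shift that must stay in a disc of fixed radius. *)
Lemma Cexp_surj (k : C) : k <> 0 -> exists l, Cexp l = k /\ Re l = ln (Cmod k) /\ Rabs (Im l) <= PI.
Proof.
  intros Hk. assert (Hm : 0 < Cmod k) by (apply Cmod_gt_0; auto).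
  assert (Hs := Cmod2_alt k). destruct k as [x y]. simpl Re in Hs; simpl Im in Hs.
  set (m := Cmod (x, y)) in *.
  assert (Hxy : (x / m) * (x / m) + (y / m) * (y / m) = 1).
  { replace 1 with (m ^ 2 / (m * m)) by (field; lra).
    rewrite Hs. field. lra. }
  assert (Hx : -1 <= x / m <= 1) by nra.
  assert (Hb := acos_bound (x / m)).
  set (s := if Rle_dec 0 y then 1 else -1).
  exists (ln m, s * acos (x / m)). simpl. repeat split.
  - unfold Cexp; simpl. rewrite exp_ln by auto.
    assert (Hsin : sqrt (1 - (x / m)²) = Rabs (y / m)).
    { rewrite <- sqrt_Rsqr_abs. f_equal. unfold Rsqr. lra. }
    assert (Hdiv : forall u, m * (u / m) = u) by (intros; field; lra).
    unfold s. destruct (Rle_dec 0 y) as [Hy|Hy].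
    + rewrite Rmult_1_l, cos_acos, sin_acos, Hsin, Rabs_pos_eq, !Hdiv; auto.
      apply Rmult_le_pos; auto. left; apply Rinv_0_lt_compat; auto.
    + replace (-1 * acos (x / m)) with (- acos (x / m)) by ring.
      rewrite cos_neg, sin_neg, cos_acos, sin_acos, Hsin, Rabs_left; auto.
      * f_equal; field; lra.
      * apply Rmult_neg_pos; [lra|apply Rinv_0_lt_compat; auto].
  - unfold s. destruct (Rle_dec 0 y); rewrite Rabs_mult, (Rabs_pos_eq (acos _)) by lra.
    + rewrite Rabs_pos_eq; lra.
    + rewrite Rabs_left; lra.
Qed.

(** Take a primitive [g] of [f' / f]. Then [f * exp (- g)] has derivative zero, and its constant
    value is absorbed by a logarithm [k]. *)
Lemma holo_log (f : C -> C) : holo f -> (forall z, f z <> 0) ->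
  exists g, holo g /\ forall z, f z = Cexp (g z).
Proof.
  intros Hf Hnz. destruct (choice _ Hf) as [f' Hf'].
  assert (Hi : forall z, Cder (fun w => / f w)%C z (f' z * - / (f z * f z))%C).
  { intros z. apply (Cder_comp Cinv f); auto. apply Cder_inv; auto. }
  assert (Hq : holo (fun z => f' z * / f z)%C).
  { apply holo_mult. apply (holo_der f); auto. intros z; eexists; apply Hi. }
  destruct (holo_primitive _ Hq) as [g Hg].
  set (phi := fun z => (f z * Cexp (0 - g z))%C).
  assert (Hphi : forall z, Cder phi z 0).
  { intros z. unfold phi.
    eapply Cder_eq.
    - apply Cder_mult; auto. apply (Cder_comp Cexp (fun w => 0 - g w)%C); [apply Cder_Cexp|].
      apply Cder_minus; auto. apply Cder_const.
    - lazy beta. field. auto. }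
  destruct (Cexp_surj (phi 0)) as [k [Hk _]].
  { apply Cmult_neq_0; auto. apply Cexp_neq0. }
  exists (fun z => k + g z)%C. split.
  - apply holo_plus; [apply holo_const|]. intros z; eexists; apply Hg.
  - intros z. rewrite Cexp_plus, Hk, <- (Cder_zero_const phi z 0 Hphi). unfold phi.
    rewrite <- Cmult_assoc, <- Cexp_plus. replace (0 - g z + g z)%C with (RtoC 0) by ring.
    rewrite Cexp_0. ring.
Qed.

(** Boundedness of [1 / f] on the disc. *)
Lemma zero_free_lower_bound (f : C -> C) (R0 : R) : holo f -> (forall z, f z <> 0) ->
  exists m, 0 < m /\ forall z, Cmod z <= R0 -> m <= Cmod (f z).
Proof.
  intros Hf Hnz.
  destruct (holo_bounded_disc (fun z => / f z)%C R0) as [M HM].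
  { intros z. destruct (Hf z) as [l Hl]. eexists. apply (Cder_comp Cinv f); [apply Cder_inv; auto|apply Hl]. }
  exists (/ (Rabs M + 1)). assert (HM1 := Rabs_pos M). split; [apply Rinv_0_lt_compat; lra|].
  intros z Hz. specialize (HM z Hz). rewrite Cmod_inv in HM by auto.
  assert (Hp : 0 < Cmod (f z)) by (apply Cmod_gt_0; auto).
  rewrite <- (Rinv_inv (Cmod (f z))). apply Rinv_le_contravar.
  - apply Rinv_0_lt_compat; auto.
  - generalize (Rle_abs M). lra.
Qed.

(* [z0] almost minimises [|f z| / (R0 - |z|)] over the points of the disc of radius [R0] with
   [|f' z| > 1]. For large [R0] the minimum is small compared with [1 / T], so that [R0 - |z|]
   hardly changes on the disc of radius [T |f z0| / 2] around [z0]. *)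
Lemma rescaling_point (f f' : C -> C) (T : R) (z1 : C) : (forall z, Cder f z (f' z)) ->
  (forall z, f z <> 0) -> 1 < Cmod (f' z1) -> 0 <= T ->
  exists z0, 1 < Cmod (f' z0) /\ forall z, Cmod (z - z0) <= T * (Cmod (f z0) / 2) ->
    Cmod (f z) <= Cmod (f z0) / 2 -> Cmod (f' z) <= 1.
Proof.
  intros Hf Hnz Hz1 HT.
  assert (Hpos : forall z, 0 < Cmod (f z)) by (intros; apply Cmod_gt_0; auto).
  (* This radius gives [Q z1 = / K], so the infimum of [Q] is at most [/ K] and an almost minimiser
     has [T * Q z0 <= / 2]. *)
  set (K := 3 * T + 1). set (R0 := Cmod z1 + K * Cmod (f z1)).
  assert (Hz1R : Cmod z1 < R0) by (unfold R0, K; specialize (Hpos z1); nra).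
  set (Q := fun z => Cmod (f z) / (R0 - Cmod z)).
  destruct (zero_free_lower_bound f R0) as [m [Hm Hlow]]; auto.
  { intros z; exists (f' z); auto. }
  assert (HR0 : 0 < R0) by (generalize (Cmod_ge_0 z1); lra).
  (* Completeness provides suprema, hence the minus sign: [- q] is the infimum of [Q]. It is
     positive because [f] is bounded below on the disc. *)
  set (S := fun x => exists z, Cmod z < R0 /\ 1 < Cmod (f' z) /\ x = - Q z).
  assert (HQm : forall z, Cmod z < R0 -> m / R0 <= Q z).
  { intros z Hz. unfold Q. specialize (Hlow z ltac:(lra)). unfold Rdiv.
    apply Rmult_le_compat; try lra.
    - left; apply Rinv_0_lt_compat; auto.
    - apply Rinv_le_contravar; [lra|]. generalize (Cmod_ge_0 z). lra. }
  destruct (completeness S) as [q [Hq1 Hq2]].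
  { exists (- (m / R0)). intros x (z & Hz & _ & ->). specialize (HQm z Hz). lra. }
  { exists (- Q z1). exists z1. auto. }
  assert (Hq0 : q < 0).
  { assert (q <= - (m / R0)).
    - apply Hq2. intros x (z & Hz & _ & ->). specialize (HQm z Hz). lra.
    - assert (0 < m / R0) by (apply Rdiv_lt_0_compat; auto). lra. }
  assert (HQ1 : - q <= / K).
  { assert (- Q z1 <= q) by (apply Hq1; exists z1; auto).
    assert (E : Q z1 = / K); [|lra]. unfold Q, R0.
    replace (Cmod z1 + K * Cmod (f z1) - Cmod z1) with (K * Cmod (f z1)) by ring.
    specialize (Hpos z1). field. unfold K; lra. }
  (* The infimum need not be attained; since it is positive, some point comes within the factor 4/3
     of it. *)
  assert (Hex : exists z0, Cmod z0 < R0 /\ 1 < Cmod (f' z0) /\ 3 * Q z0 < 4 * - q).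
  { apply NNPP. intros Hn. assert (q <= 4 / 3 * q); [|lra]. apply Hq2.
    intros x (z & Hz & Hz' & ->). apply Rnot_lt_le. intros Hlt. apply Hn. exists z.
    repeat split; auto. lra. }
  destruct Hex as (z0 & Hz0 & Hz0' & HQ0).
  exists z0. split; auto. intros z Hz Hfz. apply Rnot_lt_le. intros Hlt.
  set (e := R0 - Cmod z0). assert (He : 0 < e) by (unfold e; lra).
  assert (Hfz0 : Cmod (f z0) = Q z0 * e) by (unfold Q; fold e; field; lra).
  assert (HTQ : T * Q z0 <= / 2).
  { assert (HK : K * / K = 1) by (apply Rinv_r; unfold K; lra).
    assert (0 < / K) by (apply Rinv_0_lt_compat; unfold K; lra).
    assert (3 * Q z0 <= 4 * / K) by lra.
    assert (T * (3 * Q z0) <= T * (4 * / K)) by (apply Rmult_le_compat_l; lra).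
    assert (3 * T * / K <= K * / K) by (apply Rmult_le_compat_r; [lra|unfold K; lra]). nra. }
  assert (Hde : Cmod (z - z0) <= e / 4).
  { eapply Rle_trans; [apply Hz|]. rewrite Hfz0. nra. }
  assert (Hze : 3 / 4 * e <= R0 - Cmod z).
  { generalize (Cmod_triangle_rev z z0). unfold e in *. lra. }
  assert (HQz : - q <= Q z).
  { assert (- Q z <= q); [|lra]. apply Hq1. exists z. repeat split; auto. lra. }
  assert (Hfz' : Cmod (f z) = Q z * (R0 - Cmod z)) by (unfold Q; field; lra).
  assert (HQ0p : 0 < Q z0) by (unfold Q; apply Rdiv_lt_0_compat; auto; lra).
  (* One factor 3/4 is the loss in the minimality of [z0], the other the change of [R0 - Cmod z].
     Together they give [9 / 16 * Cmod (f z0)], which exceeds half of [Cmod (f z0)]. *)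
  assert (X1 : 3 / 4 * Q z0 * (3 / 4 * e) <= Q z * (R0 - Cmod z)).
  { apply Rmult_le_compat; try nra. }
  assert (0 < Q z0 * e) by (apply Rmult_lt_0_compat; auto).
  rewrite Hfz', Hfz0 in Hfz. nra.
Qed.

(* By Harnack's inequality [Re G] at a point is at most twice its distance to the nearest zero [p]
   of [Re G], times [|G' p| <= 1]; and there is a zero within distance 5 of 0. Hence [Re G] grows at
   most linearly, so [G''] is [O (1 / T)]. *)
Lemma near_affine (G G' : C -> C) (T : R) : (forall z, Cder G z (G' z)) -> 20 <= T ->
  Re (G 0) = ln 2 -> / 2 <= Cmod (G' 0) ->
  (forall y, Cmod y <= T -> Re (G y) = 0 -> Cmod (G' y) <= 1) ->
  Cmod (G' 0) <= 16 /\ forall y, Cmod y <= T / 16 -> Cmod (G' y - G' 0) <= 512 / T * Cmod y.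
Proof.
  intros HG HT H0 H0' Hzero.
  assert (HGh : holo G) by (intros z; exists (G' z); auto).
  assert (HG'h := holo_der G G' HG).
  destruct (choice _ HG'h) as [G'' HG''].
  assert (Hln : ln 2 <= 1).
  { rewrite <- (ln_exp 1). apply ln_le; [lra|]. generalize (exp_ineq1 1). lra. }
  assert (Hln0 : 0 < ln 2) by (rewrite <- ln_1; apply ln_increasing; lra).
  (* The radius 5 is large enough: if [Re G] were positive on that disc, the gradient at 0 would be
     at most [2 * ln 2 / 5], which is below 1/2. *)
  assert (Hp0 : exists p0, Cmod p0 <= 5 /\ Re (G p0) <= 0).
  { apply NNPP. intros Hn.
    assert (X : Cmod (G' 0) <= 2 * Re (G 0) / 5).
    { apply (gradient_estimate G 0); auto; [lra|]. intros w Hw.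
      replace (w - 0)%C with w in Hw by ring. left. apply Rnot_le_lt. intros Hle. apply Hn. exists w; auto. }
    rewrite H0 in X. lra. }
  destruct Hp0 as [p0 [Hp0 Hp0']].
  (* From [y] the nearest zero of [Re G] lies at distance at most [Cmod y + 5 <= T / 2], so it is
     still in the disc where [Hzero] applies, and Hopf's constant 2 turns this distance into [T]. If
     [Re (G y)] is negative, the point 0, where [Re G] is [ln 2], plays the part of [p0]. *)
  assert (HV : forall y, Cmod y <= T / 4 -> Rabs (Re (G y)) <= T).
  { intros y Hy.
    assert (Hpz : forall p, Cmod (p - y) <= Cmod y + 5 -> Cmod p <= T).
    { intros p Hp. replace p with ((p - y) + y)%C by ring. eapply Rle_trans; [apply Cmod_triangle|]. lra. }
    assert (Hy0 := Cmod_ge_0 y).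
    destruct (Rtotal_order (Re (G y)) 0) as [Hneg|[Hz|Hpos]].
    - rewrite Rabs_left by auto.
      destruct (nearest_zero (fun z => (-(1)) * G z)%C y 0) as (p & [Hp1 Hp2] & Hpz0 & Hpp).
      + apply holo_mult; auto. apply holo_const.
      + simpl. unfold Re in Hneg. lra.
      + simpl. unfold Re in H0. lra.
      + replace (0 - y)%C with (- y)%C in Hp2 by ring. rewrite Cmod_opp in Hp2.
        assert (X : Re (-(1) * G y)%C <= 2 * Cmod (p - y) * Cmod (- (1) * G' p)).
        { apply (hopf (fun z => (-(1)) * G z)%C y p); auto.
          - apply holo_mult; auto. apply holo_const.
          - apply Cder_scal; auto. }
        rewrite Cmod_mult, Cmod_m1, Rmult_1_l in X.
        assert (Hpr : Re (G p) = 0) by (simpl in Hpz0; unfold Re; lra).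
        assert (Y := Hzero p (Hpz p ltac:(lra)) Hpr).
        replace (Re (-(1) * G y)%C) with (- Re (G y)) in X by (destruct (G y); simpl; ring).
        nra.
    - rewrite Hz, Rabs_R0. lra.
    - rewrite Rabs_pos_eq by lra.
      destruct (nearest_zero G y p0) as (p & [Hp1 Hp2] & Hpz0 & Hpp); auto.
      assert (Hpy : Cmod (p - y) <= Cmod y + 5).
      { eapply Rle_trans; [apply Hp2|]. eapply Rle_trans; [apply Cmod_triangle|]. rewrite Cmod_opp. lra. }
      assert (X : Re (G y) <= 2 * Cmod (p - y) * Cmod (G' p)) by (apply (hopf G y p); auto).
      assert (Y := Hzero p (Hpz p Hpy) Hpz0). nra. }
  assert (H1 : forall y, Cmod y <= T / 8 -> Cmod (G' y) <= 16).
  { intros y Hy. replace 16 with (2 * T / (T / 8)) by (field; lra).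
    apply (gradient_bound G y); auto; [lra|]. intros w Hw. apply HV.
    replace w with ((w - y) + y)%C by ring. eapply Rle_trans; [apply Cmod_triangle|]. lra. }
  assert (H2 : forall y, Cmod y <= T / 16 -> Cmod (G'' y) <= 512 / T).
  { intros y Hy. replace (512 / T) with (2 * 16 / (T / 16)) by (field; lra).
    apply (gradient_bound G' y); auto; [lra|]. intros w Hw. eapply Rle_trans; [apply re_le_Cmod|]. apply H1.
    replace w with ((w - y) + y)%C by ring. eapply Rle_trans; [apply Cmod_triangle|]. lra. }
  split.
  - apply H1. rewrite Cmod_0. lra.
  - intros y Hy.
    assert (X := Cmod_increment_le G' G'' 0 y (512 / T) HG'').
    replace (y - 0)%C with y in X by ring. apply X. intros t Ht. apply H2.
    assert (L := Cmod_lin_le 0 y t Ht).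
    replace (lin 0 y t - 0)%C with (lin 0 y t) in L by ring. replace (y - 0)%C with y in L by ring. lra.
Qed.

Lemma Cmod_lin_ball (a b c : C) (t M : R) : 0 <= t <= 1 -> Cmod (a - c) <= M -> Cmod (b - c) <= M ->
  Cmod (lin a b t - c) <= M.
Proof.
  intros Ht Ha Hb.
  replace (lin a b t - c)%C with (RtoC (1 - t) * (a - c) + RtoC t * (b - c))%C by (unfold lin; rewrite RtoC_minus; ring).
  eapply Rle_trans; [apply Cmod_triangle|]. rewrite !Cmod_mult, !Cmod_R, !Rabs_pos_eq by lra. nra.
Qed.

(** On the rescaled disc [f] is [rho * exp (G y)] with [G y] close to [b + a * y]. Choosing [be]
    with [exp be = a * exp b] and substituting [y = (x - be) / a] makes the constant in front of
    [exp x] equal to [rho / a], which is also the scale of the variable; hence the same [sg] in both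
    places. *)
Lemma exp_rescaling (f f' : C -> C) (z1 : C) (eta L : R) : (forall z, Cder f z (f' z)) ->
  (forall z, f z <> 0) -> 1 < Cmod (f' z1) -> 0 < eta -> 0 <= L ->
  exists (w sg : C) (E : C -> C), sg <> 0 /\
    (forall x, f (w + sg * x)%C = (sg * Cexp (x + E x))%C) /\
    (forall x, Cmod x <= L -> Cmod (E x) <= eta) /\
    (forall x y, Cmod x <= L -> Cmod y <= L -> Cmod (E x - E y) <= eta * Cmod (x - y)).
Proof.
  intros Hf Hnz Hz1 Heta HL.
  (* The number 36 bounds [Cmod be]. The disc of radius [L1] contains [be] and bounds [x - be] for
     [Cmod x <= L]. As [Cmod a >= / 2], the points [y] stay within [L']. The term [16 * L'] of [T]
     puts them in the range of [near_affine], and [1024 * L' / e1] makes its error at most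
     [e1 / 2]. *)
  set (L1 := L + 36). set (L' := 2 * (L1 + 36)). set (e1 := eta / L1).
  assert (HLL1 : L1 = L + 36) by reflexivity.
  assert (HL1 : 36 <= L1) by lra.
  assert (He1 : 0 < e1) by (apply Rdiv_lt_0_compat; lra).
  set (T := 20 + 16 * L' + 1024 * L' / e1).
  assert (HT0 : 0 <= 1024 * L' / e1) by (apply Rmult_le_pos; [unfold L'; lra|left; apply Rinv_0_lt_compat; auto]).
  assert (HT : 20 <= T) by (unfold T, L' in *; lra).
  destruct (holo_log f) as [g [Hg Hfg]]; auto. { intros z; exists (f' z); auto. }
  destruct (choice _ Hg) as [g' Hg'].
  assert (Hf'g' : forall z, f' z = (g' z * f z)%C).
  { intros z. apply (Cder_unique f z); auto.
    apply (Cder_ext (fun z => Cexp (g z))); [intros; auto|]. rewrite (Hfg z).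
    apply (Cder_comp Cexp g); auto. apply Cder_Cexp. }
  assert (Hmf : forall z, Cmod (f z) = exp (Re (g z))) by (intros; rewrite Hfg; apply Cmod_Cexp).
  destruct (rescaling_point f f' T z1) as [z0 [Hz0 Hz0']]; auto; [lra|].
  set (rho := Cmod (f z0) / 2) in *.
  assert (Hrho : 0 < rho) by (unfold rho; generalize (proj1 (Cmod_gt_0 _) (Hnz z0)); lra).
  assert (Hrho0 : RtoC rho <> 0) by (intro X; injection X; lra).
  (* Subtracting [ln rho] makes the zeros of [Re G] the points where [|f| = rho = |f z0| / 2]. There
     [|f'| <= 1] by the choice of [z0], and [f' = g' * f] turns this into [|G'| <= 1]. *)
  set (G := fun y => (- RtoC (ln rho) + 1 * g (z0 + RtoC rho * y))%C).
  set (G' := fun y => (RtoC rho * g' (z0 + RtoC rho * y))%C).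
  assert (HG : forall y, Cder G y (G' y)).
  { intros y. unfold G, G'. eapply Cder_eq.
    - apply Cder_plus; [apply Cder_const|]. apply Cder_scal. apply Cder_comp_affine. apply Hg'.
    - ring. }
  assert (HReG : forall y, Re (G y) = Re (g (z0 + RtoC rho * y)%C) - ln rho).
  { intros y. unfold G. destruct (g (z0 + RtoC rho * y)%C); simpl. ring. }
  assert (Hz00 : (z0 + RtoC rho * 0)%C = z0) by ring.
  assert (H0 : Re (G 0) = ln 2).
  { rewrite HReG, Hz00. replace (Re (g z0)) with (ln (2 * rho)).
    - rewrite ln_mult by lra. lra.
    - replace (2 * rho) with (Cmod (f z0)) by (unfold rho; field). rewrite Hmf, ln_exp. auto. }
  assert (HmG' : forall y, Cmod (G' y) = rho * Cmod (g' (z0 + RtoC rho * y)%C)).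
  { intros y. unfold G'. rewrite Cmod_mult, Cmod_R, Rabs_pos_eq; lra. }
  assert (H0' : / 2 <= Cmod (G' 0)).
  { rewrite HmG', Hz00. rewrite Hf'g', Cmod_mult in Hz0.
    replace (Cmod (f z0)) with (2 * rho) in Hz0 by (unfold rho; field). lra. }
  destruct (near_affine G G' T HG HT H0 H0') as [Ha16 Hnear].
  { intros y Hy Hy0.
    assert (Hm : Cmod (f (z0 + RtoC rho * y)%C) = rho).
    { rewrite Hmf. rewrite HReG in Hy0. replace (Re _) with (ln rho) by lra. apply exp_ln; auto. }
    assert (X := Hz0' (z0 + RtoC rho * y)%C).
    replace (z0 + RtoC rho * y - z0)%C with (RtoC rho * y)%C in X by ring.
    rewrite Cmod_mult, Cmod_R, Rabs_pos_eq, Hm, Hf'g', Cmod_mult, Hm in X by lra.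
    rewrite HmG', Rmult_comm. apply X; nra. }
  set (a := G' 0) in *. set (b := G 0) in *.
  assert (Ha : a <> 0) by (apply Cmod_gt_0; lra).
  destruct (Cexp_surj (a * Cexp b)) as (be & Hbe & HbR & HbI).
  { apply Cmult_neq_0; auto. apply Cexp_neq0. }
  assert (Hbe36 : Cmod be <= 36).
  { eapply Rle_trans; [apply Cmod_le_Re_Im|]. rewrite HbR.
    rewrite Cmod_mult, Cmod_Cexp, H0, exp_ln by lra.
    assert (0 <= ln (Cmod a * 2)) by (rewrite <- ln_1; apply ln_le; lra).
    assert (ln (Cmod a * 2) <= 31).
    { rewrite <- (ln_exp 31). apply ln_le; [lra|]. generalize (exp_ineq1_le 31). lra. }
    rewrite Rabs_pos_eq by auto. generalize PI_4. lra. }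
  set (yy := fun x => ((x - be) / a)%C).
  set (E := fun x => (G (yy x) - b - (x - be))%C).
  assert (Hyy : forall x, Cmod x <= L1 -> Cmod (yy x) <= L').
  { intros x Hx. unfold yy. rewrite Cmod_div by auto. apply Rle_div_l; [lra|].
    assert (Cmod (x - be) <= L1 + 36).
    { eapply Rle_trans; [apply Cmod_triangle|]. rewrite Cmod_opp. lra. }
    unfold L'. assert (0 <= L1 + 36) by lra. nra. }
  assert (HLT : L' <= T / 16) by (unfold T; lra).
  assert (HLip : forall x y, Cmod x <= L1 -> Cmod y <= L1 -> Cmod (E x - E y) <= e1 * Cmod (x - y)).
  { intros x y Hx Hy.
    set (K := fun z => (G z - a * z)%C).
    assert (HK : forall z, Cder K z (G' z - a * 1)%C).
    { intros z. apply Cder_minus; auto. apply Cder_scal, Cder_id. }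
    replace (E x - E y)%C with (K (yy x) - K (yy y))%C by (unfold E, K, yy; field; auto).
    eapply Rle_trans; [apply (Cmod_increment_le K (fun z => G' z - a * 1)%C (yy y) (yy x) (e1 / 2) HK)|].
    - intros t Ht. replace (G' (lin (yy y) (yy x) t) - a * 1)%C with (G' (lin (yy y) (yy x) t) - a)%C by ring.
      assert (Hlin : Cmod (lin (yy y) (yy x) t) <= L').
      { replace (lin (yy y) (yy x) t) with (lin (yy y) (yy x) t - 0)%C by ring.
        apply Cmod_lin_ball; auto.
        - replace (yy y - 0)%C with (yy y) by ring. auto.
        - replace (yy x - 0)%C with (yy x) by ring. auto. }
      eapply Rle_trans; [apply Hnear; lra|].
      apply Rle_trans with (512 / T * L').
      + apply Rmult_le_compat_l; auto. apply Rmult_le_pos; [lra|]. left; apply Rinv_0_lt_compat; lra.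
      + replace (512 / T * L') with (512 * L' / T) by (field; lra). apply Rle_div_l; [lra|].
        assert (HTe : 1024 * L' / e1 <= T) by (unfold T, L' in *; lra).
        apply Rle_div_l in HTe; auto. lra.
    - replace (yy x - yy y)%C with ((x - y) / a)%C by (unfold yy; field; auto).
      rewrite Cmod_div by auto.
      assert (Cmod (x - y) / Cmod a <= 2 * Cmod (x - y)).
      { apply Rle_div_l; [lra|]. generalize (Cmod_ge_0 (x - y)). nra. }
      assert (e1 / 2 * (Cmod (x - y) / Cmod a) <= e1 / 2 * (2 * Cmod (x - y))) by (apply Rmult_le_compat_l; lra).
      lra. }
  assert (Hsmall : e1 * L1 = eta) by (unfold e1; field; lra).
  exists (z0 - RtoC rho * be / a)%C, (RtoC rho / a)%C, E. repeat split.
  - unfold Cdiv. apply Cmult_neq_0; auto. apply Cmod_gt_0. rewrite Cmod_inv by auto. apply Rinv_0_lt_compat; lra.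
  - intros x.
    replace (z0 - RtoC rho * be / a + RtoC rho / a * x)%C with (z0 + RtoC rho * yy x)%C by (unfold yy; field; auto).
    rewrite Hfg.
    replace (g (z0 + RtoC rho * yy x)%C) with (RtoC (ln rho) + G (yy x))%C by (unfold G; ring).
    replace (x + E x)%C with (be + (G (yy x) - b))%C by (unfold E; ring).
    rewrite (Cexp_plus be), Hbe, Cexp_plus.
    replace (Cexp (RtoC (ln rho))) with (RtoC rho).
    2:{ unfold Cexp; simpl. rewrite exp_ln, sin_0, cos_0 by auto. unfold RtoC. f_equal; ring. }
    transitivity (RtoC rho * (Cexp b * Cexp (G (yy x) - b)))%C.
    + rewrite <- Cexp_plus. do 2 f_equal. ring.
    + field; auto.
  - intros x Hx.
    (* [E] vanishes at [be], so the Lipschitz bound also controls the size of [E]. *)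
    assert (X := HLip x be ltac:(lra) ltac:(lra)).
    replace (E be) with (RtoC 0) in X.
    2:{ unfold E. replace (yy be) with (RtoC 0) by (unfold yy; field; auto). fold b. ring. }
    replace (E x - 0)%C with (E x) in X by ring.
    assert (Cmod (x - be) <= L1).
    { eapply Rle_trans; [apply Cmod_triangle|]. rewrite Cmod_opp. unfold L1. lra. }
    rewrite <- Hsmall. eapply Rle_trans; [apply X|]. apply Rmult_le_compat_l; lra.
  - intros x y Hx Hy. eapply Rle_trans; [apply HLip; unfold L1; lra|].
    apply Rmult_le_compat_r; [apply Cmod_ge_0|]. nra.
Qed.

(** * Solving the perturbed exponential equations by contraction *)

Lemma exp_small_le2 (r : R) : r <= / 8 -> exp r <= 2.
Proof.
  intros Hr. assert (E : exp (/ 2) * exp (/ 2) = exp 1) by (rewrite <- exp_plus; f_equal; lra).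
  assert (X := exp_le_3). assert (Y := exp_pos (/ 2)).
  assert (exp r <= exp (/ 2)); [|nra].
  destruct (Rle_lt_or_eq_dec r (/ 2)) as [Hl|Heq]; [lra| |rewrite Heq; lra].
  left. apply exp_increasing; auto.
Qed.

(** On the disc of radius 1/8 the derivative [Cexp z - 1] has modulus at most [2 * / 8]. *)
Lemma Cexp_minus_id_lipschitz (x y : C) : Cmod x <= / 8 -> Cmod y <= / 8 ->
  Cmod (Cexp x - Cexp y - (x - y)) <= / 4 * Cmod (x - y).
Proof.
  intros Hx Hy.
  assert (H2 : forall z, Cmod z <= / 8 -> Cmod (Cexp z) <= 2).
  { intros z Hz. rewrite Cmod_Cexp. apply exp_small_le2.
    generalize (re_le_Cmod z) (Rle_abs (Re z)). lra. }
  assert (Hball : forall a b t, Cmod a <= / 8 -> Cmod b <= / 8 -> 0 <= t <= 1 -> Cmod (lin a b t) <= / 8).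
  { intros a b t Ha Hb Ht. replace (lin a b t) with (lin a b t - 0)%C by ring. apply Cmod_lin_ball; auto.
    - replace (a - 0)%C with a by ring. auto.
    - replace (b - 0)%C with b by ring. auto. }
  assert (H1 : forall z, Cmod z <= / 8 -> Cmod (Cexp z - 1) <= / 4).
  { intros z Hz. rewrite <- Cexp_0.
    eapply Rle_trans; [apply (Cmod_increment_le Cexp Cexp 0 z 2)|].
    - apply Cder_Cexp.
    - intros t Ht. apply H2, Hball; auto. rewrite Cmod_0; lra.
    - replace (z - 0)%C with z by ring. lra. }
  replace (Cexp x - Cexp y - (x - y))%C with ((Cexp x - x) - (Cexp y - y))%C by ring.
  apply (Cmod_increment_le (fun z => Cexp z - z)%C (fun z => Cexp z - 1)%C).
  - intros z. apply Cder_minus; [apply Cder_Cexp|apply Cder_id].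
  - intros t Ht. apply H1, Hball; auto.
Qed.

(** Banach's fixed point theorem for [(u, v) -> (N1 u v, N2 v u)] in the maximum distance, expressed
    by a common bound [d]. Both maps take their own unknown first, so that one family of maps can
    serve for both equations. *)
Lemma pair_contraction (N1 N2 : C -> C -> C) (y0 : C) (r : R) : 0 <= r ->
  (forall u v, Cmod (u - y0) <= r -> Cmod (v - y0) <= r ->
    Cmod (N1 u v - y0) <= r /\ Cmod (N2 u v - y0) <= r) ->
  (forall u v u' v' d, Cmod (u - y0) <= r -> Cmod (v - y0) <= r ->
    Cmod (u' - y0) <= r -> Cmod (v' - y0) <= r -> Cmod (u - u') <= d -> Cmod (v - v') <= d ->
    Cmod (N1 u v - N1 u' v') <= d / 2 /\ Cmod (N2 u v - N2 u' v') <= d / 2) ->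
  exists u v, Cmod (u - y0) <= r /\ Cmod (v - y0) <= r /\ N1 u v = u /\ N2 v u = v.
Proof.
  intros Hr Hball Hlip.
  set (X := fun n => Nat.iter n (fun p : C * C => (N1 (fst p) (snd p), N2 (snd p) (fst p))) (y0, y0)).
  set (u := fun n => fst (X n)). set (v := fun n => snd (X n)).
  assert (Hu : forall n, u (S n) = N1 (u n) (v n)) by reflexivity.
  assert (Hv : forall n, v (S n) = N2 (v n) (u n)) by reflexivity.
  assert (Hb : forall n, Cmod (u n - y0) <= r /\ Cmod (v n - y0) <= r).
  { induction n.
    - unfold u, v; simpl. replace (y0 - y0)%C with (RtoC 0) by ring. rewrite Cmod_0. auto.
    - destruct IHn as [A1 A2]. rewrite Hu, Hv. split; apply Hball; auto. }
  set (K := 2 * r).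
  assert (Hstep : forall n, Cmod (u (S n) - u n) <= K * (/ 2) ^ n /\ Cmod (v (S n) - v n) <= K * (/ 2) ^ n).
  { induction n.
    - unfold K. simpl pow. rewrite Rmult_1_r.
      assert (Y : forall a b, Cmod (a - y0) <= r -> Cmod (b - y0) <= r -> Cmod (a - b) <= 2 * r).
      { intros a b A1 A2. replace (a - b)%C with ((a - y0) - (b - y0))%C by ring.
        eapply Rle_trans; [apply Cmod_triangle|]. rewrite Cmod_opp. lra. }
      split; apply Y; apply Hb.
    - destruct IHn as [A1 A2].
      destruct (Hb n) as [B1 B2]. destruct (Hb (S n)) as [B3 B4].
      replace (K * (/ 2) ^ S n) with (K * (/ 2) ^ n / 2) by (simpl; field).
      destruct (Hlip (u (S n)) (v (S n)) (u n) (v n) (K * (/ 2) ^ n)) as [A3 _]; [auto ..|].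
      destruct (Hlip (v (S n)) (u (S n)) (v n) (u n) (K * (/ 2) ^ n)) as [_ A4]; [auto ..|].
      exact (conj A3 A4). }
  destruct (geometric_limit u K) as [p Hp]; [apply Hstep|].
  destruct (geometric_limit v K) as [q Hq]; [apply Hstep|].
  assert (Hin : forall (s : nat -> C) l, (forall n, Cmod (s n - l) <= 2 * K * (/ 2) ^ n) ->
    (forall n, Cmod (s n - y0) <= r) -> Cmod (l - y0) <= r).
  { intros s l Hs Hsb. apply le_epsilon. intros eps He.
    destruct (half_pow_small (2 * K) eps He) as [n Hn]. specialize (Hn n (le_n _)).
    specialize (Hs n). specialize (Hsb n).
    replace (l - y0)%C with ((s n - y0) - (s n - l))%C by ring.
    eapply Rle_trans; [apply Cmod_triangle|]. rewrite Cmod_opp. lra. }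
  assert (Hpb : Cmod (p - y0) <= r) by (apply (Hin u); auto; apply Hb).
  assert (Hqb : Cmod (q - y0) <= r) by (apply (Hin v); auto; apply Hb).
  assert (Hfix : forall a b, (forall n, Cmod (a - b) <= 2 * (2 * K) * (/ 2) ^ n) -> a = b).
  { intros a b Hab. replace a with (a - b + b)%C by ring.
    rewrite (Cmod_le_zero_pow (a - b) (2 * (2 * K)) (/ 2)); [ring|lra|auto]. }
  assert (HK : 0 <= K) by (unfold K; lra).
  exists p, q. repeat split; auto.
  - apply Hfix. intros n. destruct (Hb n) as [B1 B2].
    replace (N1 p q - p)%C with ((u (S n) - p) - (N1 (u n) (v n) - N1 p q))%C by (rewrite Hu; ring).
    eapply Rle_trans; [apply Cmod_triangle|]. rewrite Cmod_opp.
    assert (A1 := Hp (S n)). simpl pow in A1. assert (A0 := half_pow_pos n).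
    assert (A2 : Cmod (N1 (u n) (v n) - N1 p q) <= 2 * K * (/ 2) ^ n / 2) by (apply Hlip; auto).
    assert (0 <= K * (/ 2) ^ n) by nra. lra.
  - apply Hfix. intros n. destruct (Hb n) as [B1 B2].
    replace (N2 q p - q)%C with ((v (S n) - q) - (N2 (v n) (u n) - N2 q p))%C by (rewrite Hv; ring).
    eapply Rle_trans; [apply Cmod_triangle|]. rewrite Cmod_opp.
    assert (A1 := Hq (S n)). simpl pow in A1. assert (A0 := half_pow_pos n).
    assert (A2 : Cmod (N2 (v n) (u n) - N2 q p) <= 2 * K * (/ 2) ^ n / 2) by (apply Hlip; auto).
    assert (0 <= K * (/ 2) ^ n) by nra. lra.
Qed.

Lemma Cexp_ipi : Cexp (RtoC PI * Ci) = (- (1))%C.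
Proof.
  unfold Cexp, Ci, RtoC; simpl.
  replace (PI * 0 - 0 * 1) with 0 by ring. replace (PI * 1 + 0 * 0) with PI by ring.
  rewrite exp_0, cos_PI, sin_PI. unfold Copp; simpl. f_equal; ring.
Qed.

Definition sign (s : C) : Prop := s = RtoC 1 \/ s = (- RtoC 1)%C.

Lemma Cmod_sign (s : C) : sign s -> Cmod s = 1.
Proof. intros [->| ->]; [apply Cmod_1|apply Cmod_m1]. Qed.
Lemma sign_sqr (s : C) : sign s -> (s * s)%C = 1.
Proof. intros [->| ->]; ring. Qed.

(* For [E = 0] both equations read [exp u = i pi], solved by [y0]; the map [N] below is Newton's
   iteration with the derivative frozen at [y0]. *)
Lemma perturbed_exp_system (E : C -> C) (s1 s2 : C) : sign s1 -> sign s2 ->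
  (forall x, Cmod x <= 20 -> Cmod (E x) <= / 100) ->
  (forall x y, Cmod x <= 20 -> Cmod y <= 20 -> Cmod (E x - E y) <= / 100 * Cmod (x - y)) ->
  exists u v,
    (Cexp (u + E u) + s1 * (E (v + s1 * Cexp (u + E u)) - E v) = RtoC PI * Ci)%C /\
    (Cexp (v + E v) + s2 * (E (u + s2 * Cexp (v + E v)) - E u) = RtoC PI * Ci)%C /\
    (s1 = s2 -> u = v).
Proof.
  intros Hs1 Hs2 HEs HEl.
  set (y0 := (ln PI, PI / 2) : C).
  assert (HPI3 : 3 <= PI) by (generalize PI2_3_2; lra).
  assert (HPI4 := PI_4).
  assert (Hy0e : Cexp y0 = (RtoC PI * Ci)%C).
  { unfold Cexp, y0, Ci, RtoC; simpl. rewrite exp_ln, cos_PI2, sin_PI2 by lra.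
    unfold Cmult; simpl. f_equal; ring. }
  assert (Hy0 : Cmod y0 <= 5).
  { eapply Rle_trans; [apply Cmod_le_Re_Im|]. unfold y0; simpl.
    assert (0 <= ln PI) by (rewrite <- ln_1; apply ln_le; lra).
    assert (ln PI <= 3).
    { rewrite <- (ln_exp 3). apply ln_le; [lra|]. generalize (exp_ineq1_le 3). lra. }
    rewrite !Rabs_pos_eq; lra. }
  set (ipi := (RtoC PI * Ci)%C) in *.
  assert (Hipi : Cmod ipi = PI).
  { unfold ipi. rewrite Cmod_mult, Cmod_Ci, Cmod_R, Rabs_pos_eq; lra. }
  assert (Hipi0 : ipi <> 0) by (apply Cmod_gt_0; lra).
  set (q := fun u => Cexp (u - y0 + E u)).
  set (P := fun u => (ipi * q u)%C).
  assert (HP : forall u, P u = Cexp (u + E u)).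
  { intros u. unfold P, q. rewrite <- Hy0e, <- Cexp_plus. f_equal. ring. }
  set (N := fun s u v => (u + 1 - q u - s * (E (v + s * P u) - E v) / ipi)%C).
  (* With this radius [u - y0 + E u] stays within 1/8, where [Cexp_minus_id_lipschitz] applies, and
     [v + s * P u] has modulus at most 6 + 8, inside the disc where [E] is controlled. *)
  set (r := / 16).
  assert (Hub : forall u, Cmod (u - y0) <= r -> Cmod u <= 6).
  { intros u Hu. replace u with ((u - y0) + y0)%C by ring. eapply Rle_trans; [apply Cmod_triangle|]. unfold r in Hu. lra. }
  assert (Hue : forall u, Cmod (u - y0) <= r -> Cmod (u - y0 + E u) <= r + / 100).
  { intros u Hu. eapply Rle_trans; [apply Cmod_triangle|]. specialize (Hub u Hu). specialize (HEs u ltac:(lra)). lra. }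
  assert (Hr8 : r + / 100 <= / 8) by (unfold r; lra).
  assert (HP8 : forall u, Cmod (u - y0) <= r -> Cmod (P u) <= 8).
  { intros u Hu. unfold P, q. rewrite Cmod_mult, Hipi, Cmod_Cexp.
    assert (exp (Re (u - y0 + E u)%C) <= 2).
    { apply exp_small_le2. generalize (re_le_Cmod (u - y0 + E u)) (Rle_abs (Re (u - y0 + E u)%C)) (Hue u Hu). lra. }
    assert (X := exp_pos (Re (u - y0 + E u)%C)). nra. }
  assert (Hvs : forall s u v, sign s -> Cmod (u - y0) <= r -> Cmod (v - y0) <= r ->
    Cmod (v + s * P u) <= 20).
  { intros s u v Hs Hu Hv. eapply Rle_trans; [apply Cmod_triangle|].
    rewrite Cmod_mult, (Cmod_sign s) by auto. specialize (HP8 u Hu). specialize (Hub v Hv). lra. }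
  assert (Hdiv : forall s z d, sign s -> Cmod z <= 3 * d -> Cmod (s * z / ipi) <= d).
  { intros s z d Hs Hz. rewrite Cmod_div, Cmod_mult, (Cmod_sign s), Hipi by auto.
    assert (0 <= d) by (generalize (Cmod_ge_0 z); lra).
    apply Rle_div_l; [lra|]. nra. }
  assert (Hball : forall s u v, sign s -> Cmod (u - y0) <= r -> Cmod (v - y0) <= r ->
    Cmod (N s u v - y0) <= r).
  { intros s u v Hs Hu Hv.
    replace (N s u v - y0)%C with (- (q u - Cexp 0 - (u - y0 + E u)) - E u
      - s * (E (v + s * P u) - E v) / ipi)%C by (unfold N; rewrite Cexp_0; ring).
    assert (A1 : Cmod (q u - Cexp 0 - ((u - y0 + E u) - 0)) <= / 4 * Cmod (u - y0 + E u - 0)).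
    { apply Cexp_minus_id_lipschitz; [specialize (Hue u Hu); lra|rewrite Cmod_0; lra]. }
    replace (u - y0 + E u - 0)%C with (u - y0 + E u)%C in A1 by ring.
    assert (A2 := Hue u Hu). assert (A3 := HEs u ltac:(generalize (Hub u Hu); lra)).
    assert (A4 : Cmod (s * (E (v + s * P u) - E v) / ipi)%C <= / 100).
    { apply Hdiv; auto. eapply Rle_trans; [apply Cmod_triangle|]. rewrite Cmod_opp.
      assert (B1 := HEs _ (Hvs s u v Hs Hu Hv)). assert (B2 := HEs v ltac:(generalize (Hub v Hv); lra)). lra. }
    eapply Rle_trans; [apply Cmod_triangle|]. eapply Rle_trans; [apply Rplus_le_compat_r, Cmod_triangle|].
    rewrite !Cmod_opp. unfold r in *. lra. }
  assert (Hlip : forall s u v u' v' d, sign s -> Cmod (u - y0) <= r -> Cmod (v - y0) <= r ->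
    Cmod (u' - y0) <= r -> Cmod (v' - y0) <= r -> Cmod (u - u') <= d -> Cmod (v - v') <= d ->
    Cmod (N s u v - N s u' v') <= d / 2).
  { intros s u v u' v' d Hs Hu Hv Hu' Hv' Hd1 Hd2.
    assert (Hd0 : 0 <= d) by (generalize (Cmod_ge_0 (u - u')); lra).
    assert (A0 : Cmod (E u - E u') <= / 100 * d).
    { eapply Rle_trans; [apply HEl|].
      - generalize (Hub u Hu); lra.
      - generalize (Hub u' Hu'); lra.
      - lra. }
    assert (A1 : Cmod ((u - y0 + E u) - (u' - y0 + E u')) <= 101 / 100 * d).
    { replace ((u - y0 + E u) - (u' - y0 + E u'))%C with ((u - u') + (E u - E u'))%C by ring.
      eapply Rle_trans; [apply Cmod_triangle|]. lra. }
    assert (A2 : Cmod (q u - q u' - ((u - y0 + E u) - (u' - y0 + E u'))) <= / 4 * (101 / 100 * d)).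
    { eapply Rle_trans; [apply Cexp_minus_id_lipschitz|].
      - generalize (Hue u Hu). lra.
      - generalize (Hue u' Hu'). lra.
      - lra. }
    assert (A3 : Cmod (q u - q u') <= 5 / 4 * (101 / 100 * d)).
    { replace (q u - q u')%C with ((q u - q u' - ((u - y0 + E u) - (u' - y0 + E u'))) + ((u - y0 + E u) - (u' - y0 + E u')))%C by ring.
      eapply Rle_trans; [apply Cmod_triangle|]. lra. }
    assert (A4 : Cmod (s * ((E (v + s * P u) - E v) - (E (v' + s * P u') - E v')) / ipi)%C <= / 10 * d).
    { apply Hdiv; auto.
      assert (B1 : Cmod (E (v + s * P u)%C - E (v' + s * P u')%C) <= / 100 * (d + 4 * (5 / 4 * (101 / 100 * d)))).
      { eapply Rle_trans; [apply HEl; apply Hvs; auto|]. apply Rmult_le_compat_l; [lra|].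
        replace (v + s * P u - (v' + s * P u'))%C with ((v - v') + s * (ipi * (q u - q u')))%C by (unfold P; ring).
        eapply Rle_trans; [apply Cmod_triangle|]. rewrite !Cmod_mult, (Cmod_sign s), Hipi by auto.
        generalize (Cmod_ge_0 (q u - q u')). nra. }
      assert (B2 : Cmod (E v - E v') <= / 100 * d).
      { eapply Rle_trans; [apply HEl|].
        - generalize (Hub v Hv); lra.
        - generalize (Hub v' Hv'); lra.
        - lra. }
      replace (E (v + s * P u) - E v - (E (v' + s * P u') - E v'))%C with
        ((E (v + s * P u) - E (v' + s * P u')) - (E v - E v'))%C by ring.
      eapply Rle_trans; [apply Cmod_triangle|]. rewrite Cmod_opp. lra. }
    replace (N s u v - N s u' v')%C with
      (- (q u - q u' - ((u - y0 + E u) - (u' - y0 + E u'))) - (E u - E u')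
       - s * ((E (v + s * P u) - E v) - (E (v' + s * P u') - E v')) / ipi)%C by (unfold N, Cdiv; ring).
    eapply Rle_trans; [apply Cmod_triangle|]. eapply Rle_trans; [apply Rplus_le_compat_r, Cmod_triangle|].
    rewrite !Cmod_opp. lra. }
  destruct (pair_contraction (N s1) (N s2) y0 r) as (u & v & Hu & Hv & Hfu & Hfv).
  - unfold r; lra.
  - intros; split; apply Hball; auto.
  - intros; split; apply Hlip; auto.
  - assert (Hsol : forall s u v, N s u v = u ->
      (Cexp (u + E u) + s * (E (v + s * Cexp (u + E u)) - E v) = ipi)%C).
    { intros s a b Hab. rewrite <- HP. unfold N in Hab.
      transitivity (P a + ipi * ((a + 1 - q a - (a + 1 - q a - s * (E (b + s * P a) - E b) / ipi))))%C.
      - field; auto.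
      - rewrite Hab. unfold P. ring. }
    exists u, v. repeat split.
    + apply Hsol; auto.
    + apply Hsol; auto.
    + intros Heq. subst s2.
      (* For equal signs [(v, u)] solves the system as well, so contraction yields that
         [Cmod (u - v)] is at most half of itself. *)
      assert (X := Hlip s1 u v v u (Cmod (u - v)) Hs1 Hu Hv Hv Hu (Rle_refl _)).
      rewrite Hfu, Hfv, (Cmod_minus_sym v u) in X. specialize (X (Rle_refl _)).
      assert (Z : (u - v)%C = 0) by (apply Cmod_eq_0; generalize (Cmod_ge_0 (u - v)); lra).
      replace u with (u - v + v)%C by ring. rewrite Z. ring.
Qed.

(** Both cases of the theorem at once: the signs 1 and -1 serve [delta = -1], while two signs 1,
    with the resulting [u = v], serve all other [delta]. *)
Lemma zero_free_shift_system (f f' : C -> C) (z1 s1 s2 : C) : (forall z, Cder f z (f' z)) ->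
  (forall z, f z <> 0) -> 1 < Cmod (f' z1) -> sign s1 -> sign s2 ->
  exists u v, f (v + s1 * f u)%C = (- f v)%C /\ f (u + s2 * f v)%C = (- f u)%C /\ (s1 = s2 -> u = v).
Proof.
  intros Hf Hnz Hz1 Hs1 Hs2.
  destruct (exp_rescaling f f' z1 (/ 100) 20) as (w & sg & E & Hsg & HE & HEs & HEl); auto; try lra.
  destruct (perturbed_exp_system E s1 s2 Hs1 Hs2 HEs HEl) as (u & v & Hu & Hv & Heq).
  exists (w + sg * u)%C, (w + sg * v)%C.
  assert (Hshift : forall s a b, sign s ->
    (Cexp (a + E a) + s * (E (b + s * Cexp (a + E a)) - E b) = RtoC PI * Ci)%C ->
    f (w + sg * b + s * f (w + sg * a))%C = (- f (w + sg * b))%C).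
  { intros s a b Hs H. rewrite !HE. set (p := Cexp (a + E a)) in *.
    replace (w + sg * b + s * (sg * p))%C with (w + sg * (b + s * p))%C by ring. rewrite HE.
    (* As [s * s = 1], the exponent at the shifted point is the old exponent plus [s] times the left
       side of the equation, hence plus or minus [i pi]; either way the value changes sign. *)
    replace (b + s * p + E (b + s * p))%C with (b + E b + s * (p + s * (E (b + s * p) - E b)))%C.
    - rewrite H, Cexp_plus. destruct Hs as [->| ->].
      + rewrite Cmult_1_l, Cexp_ipi. ring.
      + replace (Cexp (- RtoC 1 * (RtoC PI * Ci))) with (- RtoC 1)%C; [ring|].
        apply (Cmult_eq_reg_l (Cexp (RtoC PI * Ci))); [apply Cexp_neq0|].
        rewrite <- Cexp_plus, Cexp_ipi.
        replace (RtoC PI * Ci + - RtoC 1 * (RtoC PI * Ci))%C with (RtoC 0) by ring. rewrite Cexp_0. ring.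
    - assert (Hss := sign_sqr s Hs).
      transitivity (b + E b + s * p + (s * s) * (E (b + s * p) - E b))%C; [ring|rewrite Hss; ring]. }
  repeat split.
  - apply Hshift; auto.
  - apply Hshift; auto.
  - intros Hss. rewrite (Heq Hss). auto.
Qed.

(** * From the functional equations to periodic orbits *)

Lemma affine_polynomial (a b : C) (f : C -> C) : (forall z, f z = (a + b * z)%C) -> is_polynomial f.
Proof.
  intros H. exists 1%nat, (fun k => match k with O => a | _ => b end). intros z.
  rewrite sum_Sn, sum_O, H. unfold plus; simpl. change (a + b * z = a * 1 + b * (z * 1))%C. ring.
Qed.

Lemma large_derivative (f f' : C -> C) : (forall z, Cder f z (f' z)) -> ~ is_polynomial f ->
  exists z, 1 < Cmod (f' z).
Proof.
  intros Hf Hp. apply NNPP. intros Hn. apply Hp.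
  apply (affine_polynomial (f 0) (f' 0)). apply (bounded_derivative_affine f f' 1); auto.
  intros z. apply Rnot_lt_le. intros Hlt. apply Hn. exists z; auto.
Qed.

Theorem proposition1p2 (f : C -> C) (delta : C)
    (f_entire : entire f) (f_transcendental : transcendental f)
    (delta_neq0 : delta <> RtoC 0) :
  exists (p : C * C) (n : nat),
    (1 <= n)%nat /\ Nat.iter n (henon f delta) p = p.
Proof.
  destruct (entire_Cder f f_entire) as [f' Hf].
  destruct (classic (delta = (- RtoC 1)%C)) as [Hd|Hd].
  - subst delta.
    destruct (classic (exists z, f z = 0)) as [[z Hz]|Hnz].
    + exists (z, z), 1%nat. split; auto. unfold henon; simpl. rewrite Hz. f_equal. ring.
    + assert (Hnz' : forall z, f z <> 0) by (intros z Hz; apply Hnz; exists z; auto).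
      destruct (large_derivative f f' Hf f_transcendental) as [z1 Hz1].
      destruct (zero_free_shift_system f f' z1 1 (- RtoC 1)) as (u & v & H1 & H2 & _);
        auto; [left; auto|right; auto|].
      (* The orbit is [(u, v)], [(v + f u, u)], [(u - f v, v + f u)], [(v, u - f v)]. *)
      exists (u, v), 4%nat. split; [lia|]. unfold henon; simpl.
      replace (f u - - RtoC 1 * v)%C with (v + 1 * f u)%C by ring. rewrite H1.
      replace (- f v - - RtoC 1 * u)%C with (u + - RtoC 1 * f v)%C by ring. rewrite H2.
      replace (- f u - - RtoC 1 * (v + 1 * f u))%C with v by ring.
      f_equal. ring.
  - set (c := (1 + delta)%C).
    assert (Hc : c <> 0).
    { intros E. apply Hd. replace delta with (c - 1)%C by (unfold c; ring). rewrite E. ring. }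
    set (k := fun z => (/ c * f z - z)%C).
    assert (Hfk : forall z, f z = (c * (z + k z))%C) by (intros z; unfold k; field; auto).
    destruct (classic (exists z, k z = 0)) as [[z Hz]|Hnz].
    + exists (z, z), 1%nat. split; auto. unfold henon; simpl. rewrite Hfk, Hz. unfold c. f_equal. ring.
    + assert (Hnz' : forall z, k z <> 0) by (intros z Hz; apply Hnz; exists z; auto).
      assert (Hk : forall z, Cder k z (/ c * f' z - 1)%C).
      { intros z. apply Cder_minus; [apply Cder_scal; auto|apply Cder_id]. }
      (* If the derivative of [k] is bounded by 1, then [k] and hence [f] is affine, contrary to
         transcendence. *)
      destruct (classic (exists z, 1 < Cmod (/ c * f' z - 1))) as [[z1 Hz1]|Hn].
      * destruct (zero_free_shift_system k _ z1 1 1 Hk Hnz' Hz1) as (u & v & H1 & _ & H3);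
          [left; auto|left; auto|].
        rewrite <- (H3 eq_refl) in H1.
        (* The map exchanges the two coordinates of this point. *)
        exists (u, u + 1 * k u)%C, 2%nat. split; [lia|]. unfold henon; simpl.
        replace (f u - delta * (u + 1 * k u))%C with (u + 1 * k u)%C by (rewrite Hfk; unfold c; ring).
        rewrite (Hfk (u + 1 * k u)%C), H1. f_equal. unfold c. ring.
      * exfalso. apply f_transcendental.
        assert (Ha := bounded_derivative_affine k _ 1 Hk).
        apply (affine_polynomial (c * k 0) (c * (1 + (/ c * f' 0 - 1)))%C).
        intros z. rewrite Hfk, Ha; [ring|].
        intros w. apply Rnot_lt_le. intros Hlt. apply Hn. exists w; auto.
Qed.
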